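(* Let $\mathcal{C}$ be a $430$-cap of $\mathrm{PG}(6,4)$ having two intersection sizes with respect to hyperplanes, that is, the set $\{|\Pi\cap\mathcal{C}| : \Pi \text{ a hyperplane of } \mathrm{PG}(6,4)\}$ has exactly two elements. Then there is no hyperplane $\Pi$ of $\mathrm{PG}(6,4)$ such that $\Pi\cap\mathcal{C}$, regarded as a set of points of $\Pi\cong\mathrm{PG}(5,4)$, is projectively equivalent to the Hill $78$-cap of $\mathrm{PG}(5,4)$.
   Context: $\mathrm{PG}(n,q)$ denotes the $n$-dimensional projective space over $\mathbb{F}_q$, whose points are the one-dimensional subspaces of an $(n+1)$-dimensional vector space over $\mathbb{F}_q$ and whose hyperplanes are the $n$-dimensional vector subspaces. A $k$-cap of $\mathrm{PG}(n,q)$ is a set of $k$ points, no three of which are collinear. The Hill $78$-cap of $\mathrm{PG}(5,4)$ is the following set of points. Regard $\mathbb{F}_{4^6}$ as a $6$-dimensional vector space over $\mathbb{F}_4$, so that its one-dimensional $\mathbb{F}_4$-subspaces are the points of $\mathrm{PG}(5,4)$. Let $z$ be a primitive element of $\mathbb{F}_{4^6}$ (a generator of its multiplicative group), and let $O=\langle z^{35}\rangle\cup z^{7}\langle z^{35}\rangle$, a set of $234=3\cdot 78$ nonzero vectors that is closed under multiplication by $\mathbb{F}_4^{*}$. The Hill $78$-cap is the set of $78$ points of $\mathrm{PG}(5,4)$ spanned by the elements of $O$. Two sets of points of projective spaces isomorphic to $\mathrm{PG}(5,4)$ are projectively equivalent if some collineation (a bijection on points induced by an invertible semilinear map of the underlying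 vector spaces) maps one onto the other. *)

(* Defs.v *)
From HB Require Import structures.
From mathcomp Require Import all_boot all_order all_algebra all_fingroup.
From mathcomp Require Import all_solvable all_field.

Set Implicit Arguments.
Unset Strict Implicit.
Unset Printing Implicit Defensive.

Import GRing.Theory.
Local Open Scope ring_scope.

HB.instance Definition _ (F : finFieldType) (V : vectType F) :=
  CanIsCountable (@VectorInternalTheory.vs2mxK F V).
HB.instance Definition _ (F : finFieldType) (V : vectType F) :
    isFinite {vspace V} :=
  CanIsFinite (@VectorInternalTheory.vs2mxK F V).

Definition point (F : finFieldType) (V : vectType F) : predArgType :=
  {P : {vspace V} | \dim P == 1%N}.
HB.instance Definition _ (F : finFieldType) (V : vectType F) :=
  SubFinite.on (point V).

Section Geometry.
Variables (F : finFieldType) (V : vectType F).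
Implicit Types (P Q R : point V) (C : {set point V}) (H : {vspace V}).

Definition collinear P Q R : Prop :=
  exists l : {vspace V},
    \dim l = 2%N /\ [/\ (val P <= l)%VS, (val Q <= l)%VS & (val R <= l)%VS].

Definition cap (k : nat) C : Prop :=
  #|C| = k /\
  {in C & &, forall P Q R,
     P != Q -> P != R -> Q != R -> ~ collinear P Q R}.

Definition hyperplane H : Prop := (\dim H).+1 = \dim {:V}.

Definition section H C : {set point V} := [set P in C | (val P <= H)%VS].

Definition two_intersection_sizes C : Prop :=
  exists m n : nat, m <> n /\
    forall k : nat,
      (exists2 H, hyperplane H & #|section H C| = k) <-> (k = m \/ k = n).

(* The section as a set of points of the projective space on the vector space *)
(* subvs_of H, that is, H in its own right.                                   *)
Definition section_in H C : {set point (subvs_of H)} :=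
  [set P : point (subvs_of H) |
    [exists Q in section H C, val Q == (linfun vsval @: val P)%VS]].

End Geometry.

(* The field F being finite, the endomorphism s is an automorphism, so that a *)
(* bijective f : {linear U -> W | s \; *:%R} is an invertible semilinear map. *)
Definition projectively_equivalent (F : finFieldType) (U W : vectType F)
    (A : {set point U}) (B : {set point W}) : Prop :=
  exists (s : {rmorphism F -> F}) (f : {linear U -> W | s \; *:%R}),
    bijective f /\
    forall Q : point W,
      Q \in B <->
      exists2 P : point U, P \in A &
        forall w : W, w \in val Q <-> exists2 u : U, u \in val P & w = f u.

Section Hill.
Variables (F : finFieldType) (L : fieldExtType F).
Implicit Type z : {unit finvect_type L}.

Definition hill_vectors z : {set {unit finvect_type L}} :=
  (<[z ^+ 35]> :|: z ^+ 7 *: <[z ^+ 35]>)%g.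

Definition hill_cap z : {set point L} :=
  [set P : point L |
    [exists x in hill_vectors z, val P == <[FinRing.uval x : L]>%VS]].

End Hill.

(* Main.v *)
From HB Require Import structures.
Require Import Defs.
From mathcomp Require Import all_boot all_order all_algebra all_fingroup.
From mathcomp Require Import all_solvable all_field.
From mathcomp Require Import zify ring.

Set Implicit Arguments.
Unset Strict Implicit.
Unset Printing Implicit Defensive.

(** A 430-cap C of PG(6,4) with two intersection sizes has no hyperplane section
    equivalent to the Hill cap, because the dual set of C would then be a lift of
    the dual set of the Hill cap, and a rank computation over the field with 4096
    elements shows that such a lift is linear, which Fourier inversion excludes.

    Let H be a hyperplane whose section is a Hill cap. A vector off H gives
    coordinates V = K * F, where K is the field with 4^6 elements and F the field
    with 4 elements; H is K * 0, and the nonzero vectors on the points of C in H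
    form the set O, the union of <z^35> and z^7 <z^35>. Let A be the set of the
    1290 nonzero vectors on the points of C, and A^(g) the sum over v in A of
    (-1)^<g,v>, for the trace form <(a,c),(x,y)> = tr(a x) + tr(c y). For nonzero g
    one has A^(g) = 4 k - 430, where k is the size of the section of C by a
    hyperplane depending on g. The section by H has size 78, which gives the value
    -118, and the moment equations force the other value to be 10, for sections of
    size 110 (two_values).

    Let D be the set of all nonzero g with A^(g) = -118. By Fourier inversion
    D^(v) = 10 - 128 [v in A] + 1280 [v = 0] (dual_fourierE). All the values are
    congruent modulo 128, hence the number of g in D with
    <g,v_1> = ... = <g,v_n> = 1 is even for n between 1 and 6 (dual_parity).

    For nonzero a, the sum of the A^(a,c) over c in F is 4 times the character sum
    of O at a. A computation of Gauss periods shows that the latter is -22 for a in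
    T and 10 otherwise, where T is the union of 11 of the 35 cosets of the group of
    order 117 (hill_fourier). Therefore each a in T has exactly one lift (a,c) in D
    and the other nonzero a have none (dual_fiber). The parity statement for the
    vectors (0,1), (x_1,0), ..., (x_n,0) with n at most 5 says that the function
    h(a) = tr(c) on T is orthogonal to the polynomial functions of degree at most 5
    in the 12 bits of a (lift_bit_parity).

    Such a function is linear on T, h(a) = tr(y a) for some y (low_degree_linear).
    Indeed orthogonality means that the sums of h(a) a^e vanish for the exponents e
    of binary weight at most 5. The characters of the group of order 117 split
    these conditions into one linear system of 11 unknowns for each class of e
    modulo 117, whose coefficients are powers of a root of unity of order 35, and
    Frobenius reduces the classes to 12. Gaussian elimination shows that 11 of the
    systems have only the zero solution (full_rank_reps), whereas the class of -1
    leaves one parameter, which is y (full_rank_minus1).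

    Finally <(a,c),(y,1)> = tr(a y) + tr(c) vanishes for all (a,c) in D with a
    nonzero, so D^(0) - D^(y,1) is at most 8, while the inversion formula makes it
    at least 1280 (no_hill_lift). *)

Import Order.TTheory GRing.Theory Num.Theory.
Local Open Scope ring_scope.

(** * Arithmetic of the field with 4096 elements in bit lists *)

(** Polynomials over the field with two elements are lists of bits, constant
    coefficient first; xorp is their sum. *)
Fixpoint xorp (s t : seq bool) : seq bool :=
  match s, t with
  | [::], _ => t
  | _, [::] => s
  | a :: s', b :: t' => (a (+) b) :: xorp s' t'
  end.

(** The residue of X^12 modulo the primitive polynomial
    X^12 + X^6 + X^4 + X + 1. Residues are lists of exactly 12 bits. *)
Definition low12 : seq bool :=
  [:: true; true; false; false; true; false;
      true; false; false; false; false; false].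
Definition zero12 : seq bool := nseq 12 false.
Definition one12 : seq bool := true :: nseq 11 false.

(** Multiplication of a residue by X, and of two residues; inv12 raises to the
    power 4094 and powx n is the residue of X^n. *)
Definition mulx (c : seq bool) : seq bool :=
  let d := false :: take 11 c in if nth false c 11 then xorp d low12 else d.

Definition mul12 (a b : seq bool) : seq bool :=
  foldr (fun x acc => let d := mulx acc in if x then xorp d b else d) zero12 a.

Definition inv12 (a : seq bool) : seq bool :=
  let b := mul12 a a in iter 10 (fun c => mul12 (mul12 c c) b) b.

Definition powx (n : nat) : seq bool := iter n mulx one12.

(** Gaussian elimination on rows of n residues, true when a pivot is found in
    each of the n columns. The inverse of each pivot is checked by a product, so
    that soundness does not rest on the irreducibility of the modulus. *)
Fixpoint full_rank (n : nat) (rows : seq (seq (seq bool))) : bool :=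
  if n is n'.+1 then
    let i := find (fun row => head zero12 row != zero12) rows in
    let p := nth [::] rows i in
    let h := inv12 (head zero12 p) in
    let p' := [seq mul12 h c | c <- behead p] in
    (mul12 (head zero12 p) h == one12) &&
    full_rank n' [seq if head zero12 row == zero12 then behead row else 
      [seq xorp c.1 (mul12 (head zero12 row) c.2) | c <- zip (behead row) p']
      | row <- take i rows ++ drop i.+1 rows]
  else true.

Arguments inv12 : simpl never.
Arguments mul12 : simpl never.

Lemma size_xorp s t : size (xorp s t) = maxn (size s) (size t).
Proof.
elim: s t => [|a s IHs] [|b t] //=; rewrite ?max0n ?maxn0 //.
by rewrite IHs maxnSS.
Qed.

Lemma size_mulx c : size c = 12%N -> size (mulx c) = 12%N.
Proof.
move=> sc; rewrite /mulx; case: ifP => _; rewrite ?size_xorp /= size_take sc //.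
Qed.

Lemma size_mul12 a b : size b = 12%N -> size (mul12 a b) = 12%N.
Proof.
move=> sb; elim: a => //= x a IHa; case: x; rewrite ?size_xorp size_mulx //.
by rewrite sb maxnn.
Qed.

Lemma size_powx n : size (powx n) = 12%N.
Proof. by elim: n => //= n IHn; rewrite size_mulx. Qed.

Lemma size_inv12 a : size a = 12%N -> size (inv12 a) = 12%N.
Proof.
move=> sa; rewrite /inv12.
suff szI m : size (iter m (fun c => mul12 (mul12 c c) (mul12 a a)) (mul12 a a)) = 12%N.
  exact: szI.
by case: m => [|m] /=; rewrite !size_mul12.
Qed.

Section Evaluation.
Variables (K : fieldType) (zeta : K).
Hypotheses (charK : 2%N \in [pchar K])
  (zetaE : zeta ^+ 12 = zeta ^+ 6 + zeta ^+ 4 + zeta + 1).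

(** The value at zeta of the polynomial with coefficient list s. *)
Definition ev (s : seq bool) : K := foldr (fun (b : bool) x => b%:R + zeta * x) 0 s.

Lemma ev_xorp s t : ev (xorp s t) = ev s + ev t.
Proof.
elim: s t => [|a s IHs] [|b t] /=; rewrite ?add0r ?addr0 //.
rewrite IHs mulrDr addrACA; congr (_ + _).
by case: a; case: b; rewrite /= ?addr0 ?add0r // addrr_pchar2.
Qed.

Lemma ev_zero12 : ev zero12 = 0.
Proof. by rewrite /= !(mulr0, addr0). Qed.

Lemma ev_one12 : ev one12 = 1.
Proof. by rewrite /= !(mulr0, addr0). Qed.

Lemma ev_rcons c b : ev (rcons c b) = ev c + b%:R * zeta ^+ size c.
Proof.
elim: c => [|a c IHc] /=; first by rewrite !(mulr0, mulr1) addrC.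
by rewrite IHc mulrDr addrA exprS (mulrCA zeta).
Qed.

Lemma ev_mulx c : size c = 12%N -> ev (mulx c) = zeta * ev c.
Proof.
case/lastP: c => // c b; rewrite size_rcons => -[sc].
rewrite /mulx nth_rcons sc ltnn eqxx -cats1 take_size_cat // cats1.
rewrite ev_rcons sc mulrDr mulrCA -exprS zetaE.
case: b; last by rewrite /= mul0r addr0 add0r.
rewrite ev_xorp mul1r [ev (false :: _)]/= add0r; congr (_ + _).
by rewrite /= !(mulr0, addr0, add0r, mulr1); ring.
Qed.

Lemma ev_mul12 a b : size b = 12%N -> ev (mul12 a b) = ev a * ev b.
Proof.
move=> sb; elim: a => [|x a IHa] /=; first by rewrite mul0r !(mulr0, addr0).
have sz := size_mul12 a sb.
have -> : ev (if x then xorp (mulx (mul12 a b)) b else mulx (mul12 a b)) =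
   x%:R * ev b + ev (mulx (mul12 a b)).
  by case: x; rewrite ?mul0r ?add0r // mul1r ev_xorp addrC.
by rewrite ev_mulx // IHa mulrDl mulrA.
Qed.

Lemma ev_powx n : ev (powx n) = zeta ^+ n.
Proof.
elim: n => [|n IHn]; first by rewrite ev_one12.
by rewrite /powx iterS ev_mulx ?size_powx // -/(powx n) IHn exprS.
Qed.

(** The linear form with coefficients row, evaluated at ys. *)
Definition relation (row : seq (seq bool)) (ys : seq K) : K :=
  \sum_(p <- zip row ys) ev p.1 * p.2.

(** Rows of n residues. *)
Definition well_sized (n : nat) (row : seq (seq bool)) :=
  (size row == n) && all (fun c => size c == 12%N) row.

Lemma relation_cons c row y ys :
  relation (c :: row) (y :: ys) = ev c * y + relation row ys.
Proof. by rewrite /relation /= big_cons. Qed.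

Lemma relation_shift row ys x : size ys = size row ->
  relation row [seq y + x | y <- ys] =
  relation row ys + ev (foldr xorp zero12 row) * x.
Proof.
elim: row ys => [|c row IHr] [|y ys] //=.
  by rewrite /relation /= !big_nil !(mulr0, addr0, mul0r).
by case=> /IHr Er; rewrite !relation_cons Er ev_xorp; ring.
Qed.

Lemma relation_scale n h row ys : well_sized n row ->
  relation [seq mul12 h c | c <- row] ys = ev h * relation row ys.
Proof.
case/andP=> _; elim: row ys => [|c row IHr] [|y ys] /=;
  rewrite /relation /= ?big_nil ?mulr0 //.
case/andP=> /eqP sc /IHr; rewrite !big_cons /relation /= => ->.
by rewrite ev_mul12 // mulrDr mulrA.
Qed.

Lemma relation_combine n g row row' ys : well_sized n row -> well_sized n row' ->
  relation [seq xorp c.1 (mul12 g c.2) | c <- zip row row'] ys =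
  relation row ys + ev g * relation row' ys.
Proof.
case/andP=> /eqP <- + /andP[/eqP/esym].
elim: row row' ys => [|c row IHr] [|c' row'] [|y ys] //=;
  rewrite /relation /= ?big_nil ?mulr0 ?addr0 //.
move=> /andP[/eqP sc wr] [srr'] /andP[/eqP sc' wr']; rewrite !big_cons /=.
have /= := IHr row' ys wr srr' wr'; rewrite /relation => ->.
by rewrite ev_xorp ev_mul12 //; ring.
Qed.

(** A system of relations of full rank has only the zero solution. *)
Lemma full_rank_sound n rows ys :
  full_rank n rows -> size ys = n -> all (well_sized n) rows ->
  {in rows, forall row, relation row ys = 0} -> {in ys, forall y, y = 0}.
Proof.
elim: n rows ys => [|n IHn] rows ys; first by move=> _ /size0nil->.
case: ys => [//|y ys] + [sys] wsr rel0; rewrite [full_rank _ _]/=.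
set i := find _ _; set p := nth _ _ _; set h := inv12 _.
set p' := [seq mul12 h c | c <- behead p].
case/andP=> hK frk.
have [i_lt|i_ge] := ltnP i (size rows); last first.
  by move: hK; rewrite /h /p nth_default.
have p_in : p \in rows by rewrite mem_nth.
have wsE row : well_sized n.+1 row -> exists c r,
   [/\ row = c :: r, size c = 12%N & well_sized n r].
  case: row => [|c r] // /andP[/= /eqP[sr] /andP[/eqP sc ar]].
  by exists c, r; rewrite /well_sized sr eqxx.
have [c0 [q [Dp sc0 wsq]]] := wsE _ (allP wsr _ p_in).
have sh : size h = 12%N by rewrite /h Dp size_inv12.
have hE : ev h * ev c0 = 1.
  by rewrite mulrC -ev_mul12 //; move/eqP: hK; rewrite Dp /= => ->; rewrite ev_one12.
clearbody h.
have p'E : p' = [seq mul12 h c | c <- q] by rewrite /p' Dp.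
have wsp' : well_sized n p'.
  case/andP: wsq => sq aq; rewrite p'E /well_sized size_map sq all_map /=.
  by apply: sub_all aq => c /eqP sc /=; rewrite size_mul12.
(* The pivot relation, scaled to have leading coefficient 1. *)
have yE : y + relation p' ys = 0.
  rewrite p'E (relation_scale h ys wsq) -[y]mul1r -hE -mulrA -mulrDr.
  by have := rel0 _ p_in; rewrite Dp relation_cons => ->; rewrite mulr0.
have ys0 : {in ys, forall y, y = 0}.
  apply: (IHn _ _ frk sys).
    rewrite all_map; apply/allP=> row row_in /=.
    have {}row_in : row \in rows.
      by move: row_in; rewrite mem_cat => /orP[/mem_take|/mem_drop].
    have [c [r [-> sc wsr']]] := wsE _ (allP wsr _ row_in).
    rewrite /=; case: ifP => // _.
    case/andP: wsr' wsp' => /eqP sr ar /andP[/eqP sp' ap'].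
    rewrite /well_sized size_map size_zip sr sp' minnn eqxx all_map /=.
    apply/allP=> -[c1 c2] /= c_in.
    have c1_in : c1 \in r.
      by rewrite -(@unzip1_zip _ _ r p') ?sr ?sp' //; apply/mapP; exists (c1, c2).
    have c2_in : c2 \in p'.
      by rewrite -(@unzip2_zip _ _ r p') ?sr ?sp' //; apply/mapP; exists (c1, c2).
    have [s1 s2] := (eqP (allP ar _ c1_in), eqP (allP ap' _ c2_in)).
    by rewrite size_xorp size_mul12 (s1, s2) ?maxnn.
  move=> _ /mapP[row row_in ->].
  have {}row_in : row \in rows.
    by move: row_in; rewrite mem_cat => /orP[/mem_take|/mem_drop].
  have [c [r [Dr sc wsr']]] := wsE _ (allP wsr _ row_in).
  have := rel0 _ row_in; rewrite Dr relation_cons /=; case: ifP => [/eqP-> | _] relr.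
    by rewrite ev_zero12 mul0r add0r in relr.
  rewrite (relation_combine _ _ wsr' wsp') -[RHS]relr addrC; congr (_ + _).
  congr (_ * _); rewrite -[relation p' ys]add0r -(addrr_pchar2 charK y) -addrA yE.
  by rewrite addr0.
have y0 : y = 0.
  rewrite -[LHS]addr0 -[RHS]yE; congr (_ + _); rewrite /relation.
  rewrite big_seq big1 // => -[c z] cz_in /=; rewrite (ys0 z) ?mulr0 //.
  have sz : size p' = size ys by case/andP: wsp' => /eqP-> _.
  by rewrite -(@unzip2_zip _ _ p' ys) ?sz //; apply/mapP; exists (c, z).
by move=> z; rewrite inE => /predU1P[->|/ys0].
Qed.

End Evaluation.

(** * The absolute trace of a finite field of characteristic two *)

Section Trace.
Variables (K : finFieldType) (n : nat).
Hypothesis cardK : #|K| = (2 ^ n)%N.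

Lemma pchar_card2X : 2%N \in [pchar K].
Proof. exact: card_finPcharP cardK _. Qed.
Let charK := pchar_card2X.

(** The absolute trace, with its value in the field itself. *)
Definition trace_sum (x : K) : K := \sum_(i < n) x ^+ (2 ^ i).

(** The absolute trace as a bit. *)
Definition trace_bit (x : K) : bool := trace_sum x != 0.

Lemma expr2n_additive d (x y : K) : (x + y) ^+ (2 ^ d) = x ^+ (2 ^ d) + y ^+ (2 ^ d).
Proof. by apply: exprDn_pchar; rewrite pnatX pnatE ?charK. Qed.

Lemma trace_sumD x y : trace_sum (x + y) = trace_sum x + trace_sum y.
Proof.
by rewrite -big_split; apply: eq_bigr => i _; apply: expr2n_additive.
Qed.

Lemma trace_sumE x : trace_sum x = (trace_bit x)%:R.
Proof.
rewrite /trace_bit; case: eqP => //= /eqP nz_tr.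
suff sq : trace_sum x ^+ 2 = trace_sum x.
  by apply: (mulfI nz_tr); rewrite mulr1 -expr2.
rewrite /trace_sum (big_morph _ (expr2n_additive 1) (expr0n K 2)).
case: (n) cardK => [|k] card2; first by rewrite !big_ord0.
rewrite big_ord_recr [RHS]big_ord_recl /= addrC.
congr (_ + _); first by rewrite -exprM -expnSr -card2 expf_card.
by apply: eq_bigr => i _; rewrite -exprM -expnSr.
Qed.

Lemma natr_addb (a b : bool) : (a (+) b)%:R = a%:R + b%:R :> K.
Proof. by case: a; case: b; rewrite /= ?addr0 ?add0r ?addrr_pchar2. Qed.

Lemma natb_inj (a b : bool) : a%:R = b%:R :> K -> a = b.
Proof. by case: a; case: b => // /eqP; rewrite ?oner_eq0 // eq_sym oner_eq0. Qed.

Lemma trace_bitD x y : trace_bit (x + y) = trace_bit x (+) trace_bit y.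
Proof.
apply: natb_inj; rewrite natr_addb -!trace_sumE; exact: trace_sumD.
Qed.

Lemma trace_bit0 : trace_bit 0 = false.
Proof. by have := trace_bitD 0 0; rewrite addr0 addbb. Qed.

(** An additive polynomial of degree less than #|K| that vanishes on K is zero,
    since it has more roots than its degree. *)
Lemma additive_poly_eq0 (c : 'I_n -> K) :
  (forall x, \sum_(i < n) c i * x ^+ (2 ^ i) = 0) -> forall i, c i = 0.
Proof.
move=> c0 i; pose p := \sum_(i < n) c i *: 'X^(2 ^ i).
have szp : (size p <= 2 ^ n.-1 + 1)%N.
  apply: (leq_trans (size_sum _ _ _)); apply/bigmax_leqP => k _.
  apply: (leq_trans (size_scale_leq _ _)); rewrite size_polyXn addn1 ltnS.
  by rewrite leq_exp2l // -ltnS prednK // (leq_ltn_trans _ (ltn_ord i)).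
have p0 : p = 0.
  apply/eqP; apply: contraTT isT => nz_p.
  have := max_poly_roots nz_p (rs := enum K) _ (enum_uniq _).
  rewrite -cardE cardK => H; suff : (2 ^ n < 2 ^ n.-1 + 1)%N.
    rewrite -[n in (2 ^ n)%N]prednK ?(leq_ltn_trans _ (ltn_ord i)) //.
    by rewrite expnS mul2n -addnn ltn_add2l ltnS leqNgt expn_gt0.
  apply: leq_trans szp; apply: H; apply/allP => x _.
  apply/eqP; rewrite horner_sum -[RHS](c0 x); apply: eq_bigr => k _.
  by rewrite hornerZ hornerXn.
have /(congr1 (fun q : {poly K} => q`_(2 ^ i))) := p0.
rewrite coef0 coef_sum (bigD1 i) //= coefZ coefXn eqxx mulr1 big1 ?addr0 // => k ne_k.
rewrite coefZ coefXn eqn_exp2l // -val_eqE eq_sym in ne_k *.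
by rewrite (negPf ne_k) mulr0.
Qed.

Lemma trace_bit_surj : exists x, trace_bit x.
Proof.
have n_gt0 : (0 < n)%N.
  by rewrite lt0n; apply: contraTneq (finNzRing_gt1 K) => n0; rewrite cardK n0.
apply/existsP; apply: contraT; rewrite negb_exists => /forallP tr0.
have one0 := additive_poly_eq0 (c := fun=> 1) _ (Ordinal n_gt0).
case/eqP: (oner_neq0 K); apply: one0 => x; under eq_bigr do rewrite mul1r.
by rewrite -/(trace_sum x) trace_sumE (negPf (tr0 x)).
Qed.

Lemma trace_bit_nondegenerate x : x != 0 -> exists y, trace_bit (y * x).
Proof.
move=> nz_x; have [y tr_y] := trace_bit_surj.
by exists (y / x); rewrite divfK.
Qed.

End Trace.

Local Notation tr := (@trace_bit _ 12).

(** * A primitive element zeta of the field with 4096 elements *)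

Lemma primitive_root_primes (R : nzRingType) (x : R) n : (0 < n)%N ->
  x ^+ n = 1 -> {in primes n, forall p, x ^+ (n %/ p) != 1} ->
  n.-primitive_root x.
Proof.
move=> n_gt0 xn1 prim_n; have [m prim_m dv_m] := prim_order_exists n_gt0 xn1.
have [->//|ne_m] := eqVneq n m; case/dvdnP: dv_m => d dE.
have d_gt1 : (1 < d)%N.
  case: d dE => [|[|d]] // dE; first by rewrite dE in n_gt0.
  by rewrite dE mul1n eqxx in ne_m.
have p_n : pdiv d \in primes n.
  by rewrite mem_primes pdiv_prime // n_gt0 dE dvdn_mulr ?pdiv_dvd.
have /eqP[] := prim_n _ p_n; apply/eqP; rewrite -(prim_order_dvd prim_m).
by rewrite dE mulnC -muln_divA ?pdiv_dvd // dvdn_mulr.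
Qed.

(** The residue of the trace of a residue. *)
Definition trace_code (c : seq bool) : seq bool :=
  foldr xorp zero12 (traject (fun d => mul12 d d) c 12).

Section Field4096.
Variables (K : finFieldType) (zeta : K).
Hypotheses (cardK : #|K| = (2 ^ 12)%N)
  (zetaE : zeta ^+ 12 = zeta ^+ 6 + zeta ^+ 4 + zeta + 1).

Let charK := pchar_card2X cardK.
Local Notation ev := (ev zeta).

Lemma zeta_powx m n : powx m = powx n -> zeta ^+ m = zeta ^+ n.
Proof. by rewrite -!(ev_powx charK zetaE) => ->. Qed.

Lemma zeta_order : zeta ^+ 4095 = 1.
Proof. by rewrite -[RHS](expr0 zeta); apply: zeta_powx; vm_compute. Qed.

(** If X^n + 1 is an invertible residue, then zeta^n is not 1. *)
Lemma zeta_subgroup_neq1 n : let c := xorp (powx n) one12 in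
  mul12 c (inv12 c) = one12 -> zeta ^+ n != 1.
Proof.
move=> c; have sc : size c = 12%N by rewrite size_xorp size_powx.
have ec : ev c = zeta ^+ n + 1 by rewrite ev_xorp // ev_one12 ev_powx.
clearbody c => cK; apply/eqP=> zn1.
have := congr1 ev cK; rewrite ev_mul12 ?size_inv12 // ec ev_one12 zn1.
by rewrite addrr_pchar2 // mul0r => /esym/eqP; rewrite oner_eq0.
Qed.

Lemma zeta_prim : 4095.-primitive_root zeta.
Proof.
have primesE : primes 4095 = [:: 3; 5; 7; 13]%N by vm_compute.
refine (primitive_root_primes (isT : 0 < 4095)%N zeta_order _).
rewrite primesE => p; rewrite !inE => /or4P[]/eqP->;
  by apply: zeta_subgroup_neq1; vm_compute.
Qed.

Lemma zeta_neq0 : zeta != 0.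
Proof.
apply/eqP=> z0; have /eqP := zeta_order; rewrite z0 expr0n.
by rewrite eq_sym oner_eq0.
Qed.

Lemma zeta_log x : x != 0 -> exists2 n, (n < 4095)%N & x = zeta ^+ n.
Proof.
move=> nz_x; have x1 : x ^+ 4095 = 1.
  apply: (mulfI nz_x); rewrite mulr1 -exprS.
  by rewrite -[RHS]expf_card cardK.
by have [i ->] := prim_rootP zeta_prim x1; exists i.
Qed.

Lemma ev_trace_code c : size c = 12%N -> ev (trace_code c) = trace_sum 12 (ev c).
Proof.
move=> sc; rewrite /trace_sum /trace_code -(big_mkord xpredT (fun i => ev c ^+ (2 ^ i))).
suff H n d : size d = 12%N -> ev (foldr xorp zero12 (traject (fun d => mul12 d d) d n)) =
    \sum_(0 <= i < n) ev d ^+ (2 ^ i).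
  exact: H.
elim: n d => [|n IHn] d sd; first by rewrite big_nil ev_zero12.
rewrite trajectS [foldr _ _ _]/= ev_xorp // IHn ?size_mul12 // big_nat_recl //.
congr (_ + _); apply: eq_bigr => i _.
by rewrite ev_mul12 // -expr2 -exprM -expnS.
Qed.

Lemma tr_zetaX i : (i < 12)%N -> tr (zeta ^+ i) = (i == 11%N).
Proof.
move=> i_lt; rewrite /trace_bit -ev_powx // -ev_trace_code ?size_powx //.
have -> : trace_code (powx i) = if i == 11%N then one12 else zero12.
  apply/eqP; have /allP := (isT : all (fun i => trace_code (powx i) ==
    if i == 11%N then one12 else zero12) (iota 0 12)).
  by apply; rewrite mem_iota.
by case: (i == 11%N); rewrite ?ev_one12 ?ev_zero12 ?oner_eq0 ?eqxx.
Qed.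

(** For this modulus, the trace reads off the leading bit of a residue. *)
Lemma tr_ev c : size c = 12%N -> tr (ev c) = nth false c 11.
Proof.
suff H i (d : seq bool) : (size d + i = 12)%N ->
    tr (zeta ^+ i * ev d) = if size d is n.+1 then nth false d n else false.
  by move=> sc; rewrite -[ev c]mul1r -(expr0 zeta) H sc.
elim: d i => [|b d IHd] i /= sd; first by rewrite mulr0 (trace_bit0 cardK).
have /IHd : (size d + i.+1 = 12)%N by rewrite addnS.
rewrite mulrDr mulrA -exprSr (trace_bitD cardK) => ->.
have -> : tr (zeta ^+ i * b%:R) = b && (i == 11%N).
  case: b; rewrite ?mulr0 ?(trace_bit0 cardK) // mulr1 tr_zetaX //.
  by move: sd; clear; lia.
have -> : (i == 11%N) = (size d == 0%N).
  by move: sd; clear; lia.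
by case: (d) => [|d0 d'] /=; rewrite ?addbF ?andbF ?andbT.
Qed.

End Field4096.

(** * The functions of low degree on T are linear *)

(** T is the union of the cosets zeta^r <zeta^35> of the group of order 117 for
    r in classesT. *)
Definition classesT : seq nat := [:: 0; 1; 2; 4; 9; 11; 16; 22; 28; 29; 32]%N.

(** The positions, below m, of the bits of n. *)
Fixpoint bits (m n : nat) : seq nat :=
  if m is m'.+1 then
    (if odd n then [:: 0%N] else [::]) ++ [seq i.+1 | i <- bits m' n./2]
  else [::].

(** Binary weight at most 5: the binary weight of e is the degree of the power
    function of exponent e as a polynomial in the 12 bits of its argument. *)
Definition low_weight (e : nat) : bool := (size (bits 12 e) <= 5)%N.

(** The k such that the exponent j + 117 k, reduced modulo 4095, has low weight. *)
Definition low_weights (j : nat) : seq nat :=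
  [seq k <- iota 0 35 | low_weight ((j + 117 * k) %% 4095)].

(** The coefficients omega^(r k), for r in classesT, where omega = zeta^117 has
    order 35. *)
Definition omega_row (omegas : seq (seq bool)) (k : nat) : seq (seq bool) :=
  [seq nth [::] omegas ((r * k) %% 35) | r <- classesT].

Definition omegas : seq (seq bool) := [seq powx (117 * i) | i <- iota 0 35].

(** Representatives of the orbits of doubling on the integers modulo 117,
    except for the orbit of -1 = 116. *)
Definition cyclotomic_reps : seq nat :=
  [:: 0; 1; 3; 5; 7; 9; 13; 17; 21; 25; 39]%N.

Definition double117 (j : nat) : nat := ((2 * j) %% 117)%N.

Lemma full_rank_reps :
  all (fun j => full_rank 11 [seq omega_row omegas k | k <- low_weights j])
    cyclotomic_reps.
Proof. by vm_compute. Qed.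

(** In the class of -1 all coefficient vectors are orthogonal to the all-one
    vector, so the rank is 10 instead of 11. As an exponent -1 is 4094. *)
Lemma omega_row_sum_minus1 : {in low_weights 4094, forall k,
  foldr xorp zero12 (omega_row omegas k) == zero12}.
Proof. by apply/allP; vm_compute. Qed.

Lemma full_rank_minus1 :
  full_rank 10 [seq behead (omega_row omegas k) | k <- low_weights 4094].
Proof. by vm_compute. Qed.

Lemma cover117 : {in iota 0 117, forall j,
  (j \in traject double117 116 12) ||
  has (fun j0 => j \in traject double117 j0 12) cyclotomic_reps}.
Proof. by apply/allP; vm_compute. Qed.

Lemma orbit116 :
  perm_eq [seq j <- iota 0 117 | j \in traject double117 116 12]
    (traject double117 116 12).
Proof. by vm_compute. Qed.

Section RankTheorem.
Variables (K : finFieldType) (zeta : K).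
Hypotheses (cardK : #|K| = (2 ^ 12)%N)
  (zetaE : zeta ^+ 12 = zeta ^+ 6 + zeta ^+ 4 + zeta + 1).
Let charK := pchar_card2X cardK.
Let zeta1 : zeta ^+ 4095 = 1 := zeta_order cardK zetaE.

(** The set T, listed. *)
Definition Tseq : seq K :=
  [seq zeta ^+ (r + 35 * i) | r <- classesT, i <- iota 0 117].

Variable m : K -> bool.

(** The power sums of the subset of T where m holds. *)
Definition power_sum (e : nat) : K := \sum_(a <- Tseq) (m a)%:R * a ^+ e.

(** The contribution of one coset to a power sum. *)
Definition class_sum (r j : nat) : K :=
  \sum_(i <- iota 0 117) (m (zeta ^+ (r + 35 * i)))%:R * zeta ^+ (r + 35 * i) ^+ j.

Lemma power_sumE e : power_sum e = \sum_(r <- classesT) class_sum r e.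
Proof. by rewrite /power_sum big_allpairs_dep. Qed.

Lemma exprM4095 n : zeta ^+ (4095 * n) = 1.
Proof. by rewrite exprM zeta1 expr1n. Qed.

Lemma class_sum_shift r j k :
  class_sum r (j + 117 * k) = zeta ^+ (117 * (r * k)) * class_sum r j.
Proof.
rewrite /class_sum big_distrr /=; apply: eq_bigr => i _.
rewrite mulrCA; congr (_ * _); rewrite exprD mulrC; congr (_ * _).
rewrite -exprM.
have -> : ((r + 35 * i) * (117 * k) = 117 * (r * k) + 4095 * (i * k))%N by ring.
by rewrite exprD (exprM4095 (i * k)) mulr1.
Qed.

Lemma expr_mod4095 (x : K) e : x != 0 -> x ^+ (e %% 4095) = x ^+ e.
Proof.
case/(zeta_log cardK zetaE) => n _ ->.
rewrite [in RHS](divn_eq e 4095) exprD -[X in X * _]exprM.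
have -> : (n * (e %/ 4095 * 4095) = 4095 * (n * (e %/ 4095)))%N by ring.
by rewrite (exprM4095 (n * _)) mul1r.
Qed.

Lemma zetaX_neq0 n : zeta ^+ n != 0.
Proof. by rewrite expf_neq0 // (zeta_neq0 cardK zetaE). Qed.

Lemma power_sum_mod e : power_sum (e %% 4095) = power_sum e.
Proof.
rewrite !power_sumE; apply: eq_bigr => r _; apply: eq_bigr => i _.
by rewrite expr_mod4095 ?zetaX_neq0.
Qed.

Hypothesis vanish : forall e, (e < 4095)%N -> low_weight e -> power_sum e = 0.

Lemma ev_omega r k :
  ev zeta (nth [::] omegas ((r * k) %% 35)) = zeta ^+ (117 * (r * k)).
Proof.
have lt35 : ((r * k) %% 35 < 35)%N by rewrite ltn_mod.
rewrite (nth_map 0%N) ?size_iota // nth_iota // add0n (ev_powx charK zetaE).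
rewrite [in RHS](divn_eq (r * k) 35) mulnDr exprD.
have -> : (117 * (r * k %/ 35 * 35) = 4095 * (r * k %/ 35))%N by ring.
by rewrite (exprM4095 (r * k %/ 35)) mul1r.
Qed.

Lemma omega_row_sized n k : n = size classesT -> well_sized n (omega_row omegas k).
Proof.
move=> ->; rewrite /well_sized size_map eqxx all_map; apply/allP=> r _ /=.
by rewrite (nth_map 0%N) ?size_iota ?ltn_mod // size_powx.
Qed.

Lemma relation_omega_row j k : k \in low_weights j ->
  relation zeta (omega_row omegas k) [seq class_sum r j | r <- classesT] = 0.
Proof.
rewrite mem_filter => /andP[lw _].
rewrite -(vanish _ lw) ?ltn_mod // power_sum_mod power_sumE.
rewrite /relation /omega_row; elim: classesT => [|r rs IHr]; first by rewrite !big_nil.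
by rewrite /= !big_cons IHr class_sum_shift ev_omega.
Qed.

Lemma class_sum_rep r j : r \in classesT -> j \in cyclotomic_reps -> class_sum r j = 0.
Proof.
move=> r_T j_rep.
suff sum0 : {in [seq class_sum r' j | r' <- classesT], forall y, y = 0}.
  by apply: sum0; apply/mapP; exists r.
apply: (full_rank_sound charK zetaE (allP full_rank_reps _ j_rep)).
- by rewrite size_map.
- by apply/allP=> _ /mapP[k _ ->]; apply: omega_row_sized.
by move=> _ /mapP[k k_in ->]; apply: relation_omega_row.
Qed.

(** When the coefficient vectors have rank 10 and are orthogonal to the all-one
    vector, the solutions are the constant vectors: the differences with the
    first coordinate solve a system of full rank. *)
Lemma class_sum_const r j :
  {in low_weights j, forall k, foldr xorp zero12 (omega_row omegas k) == zero12} ->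
  full_rank 10 [seq behead (omega_row omegas k) | k <- low_weights j] ->
  r \in classesT -> class_sum r j = class_sum 0 j.
Proof.
move=> sum0 frk; set y0 := class_sum 0 j.
pose zs := [seq class_sum r j + y0 | r <- behead classesT].
have zs0 : {in zs, forall z, z = 0}.
  apply: (full_rank_sound charK zetaE frk); first by rewrite size_map.
    apply/allP=> _ /mapP[k _ ->].
    by have /andP[] := omega_row_sized k (erefl 11%N).
  move=> _ /mapP[k k_in ->].
  have := relation_shift zeta charK (row := omega_row omegas k)
            (ys := [seq class_sum r j | r <- classesT]) y0.
  rewrite !size_map => /(_ erefl).
  rewrite relation_omega_row // (eqP (sum0 _ k_in)) ev_zero12.
  have -> : [seq y + y0 | y <- [seq class_sum r j | r <- classesT]] = (y0 + y0) :: zs.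
    by rewrite -map_comp.
  have -> : omega_row omegas k =
    nth [::] omegas ((0 * k) %% 35) :: behead (omega_row omegas k) by [].
  by rewrite relation_cons addrr_pchar2 // !(mulr0, mul0r, add0r, addr0).
rewrite inE => /predU1P[-> //|r_T]; apply/eqP.
by rewrite -subr_eq0 oppr_pchar2 //; apply/eqP/zs0/mapP; exists r.
Qed.

Lemma class_sum_minus1 r : r \in classesT -> class_sum r 4094 = class_sum 0 4094.
Proof. exact: class_sum_const omega_row_sum_minus1 full_rank_minus1. Qed.

Section Inversion.
Variables (r i0 : nat).
Hypotheses (r_T : r \in classesT) (i0_lt : (i0 < 117)%N).
Let a0 := zeta ^+ (r + 35 * i0).

(** The Fourier coefficients of m on the coset of a0, normalized at a0. They
    depend on j modulo 117 only, and doubling j squares them since m takes its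
    values in the field with two elements. *)
Definition twisted_sum (j : nat) : K := (a0^-1) ^+ j * class_sum r j.

Lemma twisted_sumE j : twisted_sum j = \sum_(i <- iota 0 117)
  (m (zeta ^+ (r + 35 * i)))%:R * (zeta ^+ (35 * i) / zeta ^+ (35 * i0)) ^+ j.
Proof.
rewrite /twisted_sum big_distrr; apply: eq_bigr => i _ /=.
rewrite mulrCA -exprMn; congr (_ * _ ^+ _).
rewrite /a0 !exprD.
have := zetaX_neq0 r; have := zetaX_neq0 (35 * i0).
move: (zeta ^+ r) (zeta ^+ (35 * i0)) (zeta ^+ (35 * i)) => x y x' nz_y nz_x.
by field; rewrite nz_x zetaX_neq0.
Qed.

Lemma twisted_sum_shift j k : twisted_sum (j + 117 * k) = twisted_sum j.
Proof.
rewrite /twisted_sum class_sum_shift exprD -!mulrA; congr (_ * _).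
rewrite mulrA -[RHS]mul1r; congr (_ * _); rewrite exprVn /a0 -exprM.
have -> : ((r + 35 * i0) * (117 * k) = 117 * (r * k) + 4095 * (i0 * k))%N by ring.
by rewrite exprD (exprM4095 (i0 * k)) mulr1 mulVf ?zetaX_neq0.
Qed.

Lemma twisted_sum_double j : twisted_sum (double117 j) = twisted_sum j ^+ 2.
Proof.
rewrite -(twisted_sum_shift _ ((2 * j) %/ 117)) /double117 (mulnC 117) addnC -divn_eq.
rewrite !twisted_sumE (big_morph _ (expr2n_additive cardK 1) (expr0n K 2)).
apply: eq_bigr => i _.
rewrite [RHS]exprMn -[X in _ = _ * X]exprM (mulnC 2 j); congr (_ * _).
by case: (m _); rewrite /= ?expr1n // expr0n.
Qed.

Lemma twisted_sum_orbit j n :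
  twisted_sum (iter n double117 j) = twisted_sum j ^+ (2 ^ n).
Proof.
elim: n => [|n IHn]; first by rewrite expr1.
by rewrite iterS twisted_sum_double IHn -exprM -expnSr.
Qed.

Lemma twisted_sum0 j : (j < 117)%N -> j \notin traject double117 116 12 ->
  twisted_sum j = 0.
Proof.
move=> j_lt /negPf j_notin; have := cover117 (x := j).
rewrite mem_iota => /(_ j_lt); rewrite j_notin => /hasP[j0 j0_rep /trajectP[n _ ->]].
by rewrite twisted_sum_orbit /twisted_sum class_sum_rep // mulr0 expr0n expn_eq0.
Qed.

Lemma twisted_sum116 : twisted_sum 116 = class_sum 0 4094 * a0.
Proof.
have a0_order : a0 ^+ 4095 = 1.
  by rewrite -exprM mulnC (exprM4095 (r + 35 * i0)).
rewrite -(twisted_sum_shift _ 34) (_ : 116 + 117 * 34 = 4094)%N; last by vm_compute.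
rewrite /twisted_sum class_sum_minus1 // mulrC; congr (_ * _).
rewrite -[LHS]mul1r -a0_order exprS -mulrA -exprMn divff ?zetaX_neq0 //.
by rewrite expr1n mulr1.
Qed.

(** Fourier inversion on the group of order 117. *)
Lemma sum_twisted_sum :
  \sum_(j <- iota 0 117) twisted_sum j = (m a0)%:R.
Proof.
have geom i : i \in iota 0 117 ->
  \sum_(j <- iota 0 117) (zeta ^+ (35 * i) / zeta ^+ (35 * i0)) ^+ j = (i == i0)%:R.
  rewrite mem_iota => /andP[_ i_lt]; set c := _ / _.
  have sum_geom : (c - 1) * \sum_(j <- iota 0 117) c ^+ j = 0.
    rewrite -[iota 0 117]/(index_iota 0 117) big_mkord -subrX1 /c exprMn exprVn.
    have x117 k : zeta ^+ (35 * k) ^+ 117 = 1.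
      by rewrite -exprM (_ : 35 * k * 117 = 4095 * k)%N; [exact: exprM4095 | ring].
    by rewrite !x117 invr1 mulr1 subrr.
  have [Di|ne_i] := eqVneq i i0.
    have -> : c = 1 by rewrite /c Di divff ?zetaX_neq0.
    under eq_bigr do rewrite expr1n.
    rewrite -[iota 0 117]/(index_iota 0 117) sumr_const_nat.
    rewrite (_ : 117 - 0 = (2 * 58).+1)%N // mulrS mulrnA.
    by rewrite (pcharf0 charK) mul0rn addr0.
  move/eqP: sum_geom; rewrite mulf_eq0 subr_eq0 => /orP[|/eqP//].
  rewrite /c (can2_eq (divfK (zetaX_neq0 _)) (mulfK (zetaX_neq0 _))) mul1r.
  rewrite (eq_prim_root_expr (zeta_prim cardK zetaE)).
  have lt35 k : (k < 117 -> 35 * k < 4095)%N.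
    by rewrite -[4095%N]/(35 * 117)%N ltn_pmul2l.
  by rewrite !modn_small ?lt35 // eqn_pmul2l // (negPf ne_i).
have i0_in : i0 \in iota 0 117 by rewrite mem_iota.
under eq_bigr do rewrite twisted_sumE.
move: (iota 0 117) (iota_uniq 0 117) i0_in geom => I uniqI i0_in geom.
rewrite exchange_big (bigD1_seq i0) //=.
rewrite -big_distrr /= geom // eqxx mulr1 big_seq_cond big1 ?addr0 //.
move=> i /andP[i_in /negPf ne_i].
by rewrite -big_distrr /= geom // ne_i mulr0.
Qed.

(** Only the orbit of -1 contributes to the inversion formula, and its
    contribution is a trace. *)
Lemma member_trace : m a0 = tr (class_sum 0 4094 * a0).
Proof.
apply: (natb_inj (K := K)); rewrite -sum_twisted_sum -(trace_sumE cardK).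
have lt117 : {in iota 0 117, forall j, (j < 117)%N}.
  by move=> j; rewrite mem_iota => /andP[].
move: (iota 0 117) lt117 orbit116 => I lt117 orbitI.
rewrite (bigID (mem (traject double117 116 12))) /= [X in _ + X]big_seq_cond.
rewrite [X in _ + X]big1 ?addr0; last first.
  by move=> j /andP[/lt117]; apply: twisted_sum0.
rewrite -big_filter (perm_big _ orbitI).
rewrite /trace_sum -(big_mkord xpredT (fun n => (class_sum 0 4094 * a0) ^+ (2 ^ n))).
have -> : traject double117 116 12 =
  [seq iter n double117 116%N | n <- index_iota 0 12] by [].
by rewrite big_map; apply: eq_bigr => n _; rewrite twisted_sum_orbit twisted_sum116.
Qed.

End Inversion.
End RankTheorem.

Lemma mem_bits n e i : i \in bits n e -> (i < n)%N.
Proof.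
elim: n e i => // n IHn e i /=; rewrite mem_cat => /orP[|/mapP[k /IHn ? ->] //].
by case: ifP; rewrite ?inE // => _ /eqP->.
Qed.

Lemma sum_bits n e : (e < 2 ^ n)%N -> (\sum_(i <- bits n e) 2 ^ i = e)%N.
Proof.
elim: n e => [|n IHn] e e_lt /=; first by rewrite big_nil; case: e e_lt.
rewrite big_cat big_map /= -[RHS]odd_double_half; congr (_ + _)%N.
  by case: odd; rewrite ?big_seq1 ?big_nil.
under eq_bigr do rewrite expnS; rewrite -big_distrr /= IHn ?mul2n //.
by rewrite ltn_half_double -mul2n -expnS.
Qed.

Section Polarization.
Variable K : finFieldType.
Hypothesis cardK : #|K| = (2 ^ 12)%N.

(** Orthogonality to the products of at most d linear forms tr (a * x) implies
    orthogonality to the powers whose exponent is a sum of at most d powers of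
    2: as x varies, tr (a * x) is an additive polynomial in x whose
    coefficients are the a^(2^i). *)
Lemma polarize (s : seq K) (w : K -> K) d :
  (forall xs, (size xs <= d)%N ->
     \sum_(a <- s) w a * \prod_(x <- xs) (tr (a * x))%:R = 0) ->
  forall exps, (size exps <= d)%N -> {in exps, forall i, i < 12}%N ->
     \sum_(a <- s) w a * a ^+ (\sum_(i <- exps) 2 ^ i)%N = 0.
Proof.
move=> w0; suff H exps xs : (size exps + size xs <= d)%N ->
    {in exps, forall i, i < 12}%N ->
    \sum_(a <- s) w a * a ^+ (\sum_(i <- exps) 2 ^ i)%N *
      \prod_(x <- xs) (tr (a * x))%:R = 0.
  move=> exps sz is_lt; have := H exps [::]; rewrite addn0 => /(_ sz is_lt) {2}<-.
  by apply: eq_bigr => a _; rewrite big_nil mulr1.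
elim: exps xs => [|i exps IHi] xs sz lt12.
  by rewrite -[RHS](w0 xs sz); apply: eq_bigr => a _; rewrite big_nil mulr1.
have {}lt12 : (i < 12)%N /\ {in exps, forall i, i < 12}%N.
  by split=> [|j j_in]; apply: lt12; rewrite inE ?eqxx // j_in orbT.
pose c (k : 'I_12) := \sum_(a <- s) w a * a ^+ (2 ^ k + \sum_(i <- exps) 2 ^ i)%N *
  \prod_(x <- xs) (tr (a * x))%:R.
have := additive_poly_eq0 cardK (c := c) _ (Ordinal lt12.1); rewrite /c /= => c0.
under eq_bigr do rewrite big_cons; apply: c0 => x.
have sz_x : (size exps + size (x :: xs) <= d)%N by rewrite addnS.
rewrite -[RHS](IHi _ sz_x lt12.2).
rewrite /c; under eq_bigr do rewrite big_distrl /=.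
rewrite exchange_big; apply: eq_bigr => a _ /=.
rewrite big_cons -(trace_sumE cardK) /trace_sum big_distrl big_distrr /=.
by apply: eq_bigr => k _; rewrite exprD exprMn; ring.
Qed.
End Polarization.

Section RankCorollary.
Variables (K : finFieldType) (zeta : K).
Hypotheses (cardK : #|K| = (2 ^ 12)%N)
  (zetaE : zeta ^+ 12 = zeta ^+ 6 + zeta ^+ 4 + zeta + 1).

(** A subset of T orthogonal to the polynomial functions of degree at most 5 is
    cut out by a linear function. *)
Theorem low_degree_linear (m : K -> bool) :
  (forall xs, (size xs <= 5)%N ->
     \sum_(a <- Tseq zeta) (m a)%:R * \prod_(x <- xs) (tr (a * x))%:R = 0 :> K) ->
  exists b, {in Tseq zeta, forall a, m a = tr (b * a)}.
Proof.
move=> parity; exists (class_sum zeta m 0 4094) => _ /allpairsP[[r i] [r_T i_in ->]].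
have i_lt : (i < 117)%N by rewrite mem_iota in i_in; case/andP: i_in.
apply: member_trace => //.
move=> e e_lt lw; rewrite /power_sum.
have := polarize cardK parity lw (@mem_bits _ _).
by rewrite sum_bits //; apply: leq_trans e_lt _.
Qed.
End RankCorollary.

(** * The character sums of the Hill cap *)

Definition sgn (b : bool) : int := (-1) ^+ b.

Lemma sgnD a b : sgn (a (+) b) = sgn a * sgn b.
Proof. by rewrite /sgn signr_addb. Qed.

Lemma sum_sgn (T : Type) (s : seq T) (p : pred T) :
  \sum_(x <- s) sgn (p x) = (size s)%:Z - ((count p s).*2)%:Z.
Proof.
elim: s => [|x s IHs]; rewrite ?big_nil // big_cons IHs /=.
by case: (p x); rewrite /sgn /=; lia.
Qed.

(** The number of elements of trace 1 in the coset zeta^r <zeta^35>. *)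
Definition period_count (r : nat) : nat :=
  count (fun c => nth false c 11) (traject (iter 35 mulx) (powx r) 117).

Lemma traject_powx r n :
  traject (iter 35 mulx) (powx r) n = [seq powx (r + 35 * i) | i <- iota 0 n].
Proof.
apply: (@eq_from_nth _ (powx r)); rewrite size_traject ?size_map ?size_iota // => i i_lt.
rewrite nth_traject // (nth_map 0%N) ?size_iota // nth_iota // add0n.
by rewrite -iterM /powx -iterD addnC mulnC.
Qed.

Lemma period_count_classes : {in iota 0 35, forall r,
  (period_count r + period_count ((r + 7) %% 35) ==
     if r \in classesT then 128 else 112)%N}.
Proof. by apply/allP; vm_compute. Qed.

Section Periods.
Variables (K : finFieldType) (zeta : K).
Hypotheses (cardK : #|K| = (2 ^ 12)%N)
  (zetaE : zeta ^+ 12 = zeta ^+ 6 + zeta ^+ 4 + zeta + 1).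
Let charK := pchar_card2X cardK.
Let zeta_prim := zeta_prim cardK zetaE.

(** The Gauss periods of order 35. *)
Definition period (e : nat) : int :=
  \sum_(i <- iota 0 117) sgn (tr (zeta ^+ (e + 35 * i))).

Lemma period_shift e : period (e + 35) = period e.
Proof.
rewrite /period -[iota 0 117]/(index_iota 0 117).
rewrite [LHS]big_nat_recr // [RHS]big_nat_recl //= addrC.
congr (_ + _).
  have -> : (e + 35 + 35 * 116 = 4095 + (e + 35 * 0))%N by lia.
  by rewrite exprD (prim_expr_order zeta_prim) mul1r.
by apply: eq_bigr => i _; congr (sgn (tr (zeta ^+ _))); lia.
Qed.

Lemma period_mod e : period (e %% 35) = period e.
Proof.
rewrite [in RHS](divn_eq e 35) addnC.
elim: (e %/ 35)%N => [|n IHn]; first by rewrite addn0.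
by rewrite mulSn addnCA addnC period_shift.
Qed.

Lemma periodE r : period r = 117%:Z - ((period_count r).*2)%:Z.
Proof.
rewrite /period sum_sgn size_iota; congr (_ - _%:Z); congr (_.*2).
have -> : period_count r =
    count (fun c => nth false c 11) [seq powx (r + 35 * i) | i <- iota 0 117].
  by rewrite -traject_powx.
rewrite count_map; apply: eq_count => i /=.
by rewrite -(ev_powx charK zetaE) tr_ev // size_powx.
Qed.

(** The vectors of the Hill cap, listed. *)
Definition Oseq : seq K :=
  [seq zeta ^+ (r + 35 * i) | r <- [:: 0; 7]%N, i <- iota 0 117].

Lemma mem_classes (s : seq nat) e : {in s, forall r, r < 35}%N ->
  (zeta ^+ e \in [seq zeta ^+ (r + 35 * i) | r <- s, i <- iota 0 117]) =
  (e %% 35 \in s)%N.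
Proof.
move=> s_lt; apply/allpairsP/idP => [[[r i] /= [r_s _ /eqP]]|e_s].
  rewrite (eq_prim_root_expr zeta_prim) => /eqP/(congr1 (modn^~ 35)).
  by rewrite !modn_dvdm // => ->; rewrite addnC mulnC modnMDl modn_small // s_lt.
exists (e %% 35, (e %% 4095) %/ 35)%N; split=> //.
  by rewrite mem_iota /= ltn_divLR // ltn_mod.
rewrite -(prim_expr_mod zeta_prim e) /=; congr (_ ^+ _).
by rewrite [LHS](divn_eq _ 35) modn_dvdm // addnC mulnC.
Qed.

Lemma uniq_classes (s : seq nat) : {in s, forall r, r < 35}%N -> uniq s ->
  uniq [seq zeta ^+ (r + 35 * i) | r <- s, i <- iota 0 117].
Proof.
move=> s_lt us; apply: (allpairs_uniq us (iota_uniq _ _)).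
move=> p q /allpairsP[[x y] [x_s y_in ->]] /allpairsP[[x' y'] [x'_s y'_in ->]].
move: y_in y'_in; rewrite !mem_iota => /andP[_ lty] /andP[_ lty'].
move=> /eqP; rewrite (eq_prim_root_expr zeta_prim) /=.
have /= lt_x := s_lt _ x_s; have /= lt_x' := s_lt _ x'_s; rewrite /= in lty lty'.
have lt4095 u v : (u < 35 -> v < 117 -> u + 35 * v < 4095)%N.
  move=> lt_u lt_v; apply: (@leq_trans (35 * v.+1)).
    by rewrite mulnS ltn_add2r.
  by rewrite -[4095%N]/(35 * 117)%N leq_pmul2l.
rewrite !modn_small ?lt4095 // => /eqP E.
have Ex : x = x' by move: lt_x lt_x' E; clear; lia.
by rewrite Ex in E *; congr (_, _); move: E; clear; lia.
Qed.

(** Equivalently, the hyperplane where the relative trace of a * x vanishes meets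
    the Hill cap in 14 points for a in T and in 22 points otherwise. *)
Lemma hill_fourier a : a != 0 ->
  \sum_(x <- Oseq) sgn (tr (a * x)) = if a \in Tseq zeta then - 22%:Z else 10%:Z.
Proof.
case/(zeta_log cardK zetaE) => e _ ->.
rewrite mem_classes; last by apply/allP.
rewrite /Oseq big_allpairs_dep big_cons big_seq1.
have shift r : \sum_(i <- iota 0 117)
    sgn (tr (zeta ^+ e * zeta ^+ (r + 35 * i))) = period (e + r).
  by apply: eq_bigr => i _; rewrite -exprD addnA.
rewrite !shift addn0 -period_mod -[period (e + 7)]period_mod -modnDml !periodE.
have := @period_count_classes (e %% 35)%N; rewrite mem_iota ltn_mod => /(_ isT)/eqP.
move: (period_count _) (period_count _) => c c' /=.
by case: ifP => _; lia.
Qed.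

Lemma size_Oseq : size Oseq = 234%N.
Proof. by rewrite size_allpairs size_iota. Qed.

End Periods.

(** * Fourier duality for sets with two intersection sizes *)

Section Fourier.
Variables (W : finZmodType) (b : W -> W -> bool).
Hypotheses (bDl : forall v, {morph b^~ v : g h / g + h >-> g (+) h})
  (bDr : forall g, {morph b g : v w / v + w >-> v (+) w})
  (ndl : forall v, v != 0 -> exists g, b g v).

Lemma sum_character (f : W -> bool) : {morph f : v w / v + w >-> v (+) w} ->
  \sum_v sgn (f v) = if [exists v, f v] then 0 else #|W|%:Z.
Proof.
move=> fD; case: existsP => [[w fw]|nf].
  suff H : \sum_v sgn (f v) = - \sum_v sgn (f v) by lia.
  rewrite [in LHS](reindex_inj (addrI w)) -sumrN; apply: eq_bigr => v _.
  by rewrite fD fw sgnD /sgn expr1 mulN1r.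
have f0 v : f v = false by apply/negP => fv; apply: nf; exists v.
under eq_bigr do rewrite f0 /sgn expr0.
by rewrite sumr_const natz.
Qed.

Lemma pairing0r g : b g 0 = false.
Proof. by have := bDr g 0 0; rewrite addr0 addbb. Qed.

Lemma pairing0l v : b 0 v = false.
Proof. by have := bDl v 0 0; rewrite addr0 addbb. Qed.

Lemma pairingN g v : b g (- v) = b g v.
Proof.
by have := bDr g v (- v); rewrite subrr pairing0r; case: (b g v); case: (b g (- v)).
Qed.

Lemma orthogonality v : \sum_g sgn (b g v) = if v == 0 then #|W|%:Z else 0.
Proof.
rewrite sum_character //; have [->|/ndl/existsP-> //] := eqVneq v 0.
by case: existsP => // -[g]; rewrite pairing0r.
Qed.

(** The Fourier transform of the indicator function of A. *)
Definition fourier (A : {set W}) (g : W) : int := \sum_(v in A) sgn (b g v).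

Lemma fourier0 A : fourier A 0 = #|A|%:Z.
Proof.
rewrite /fourier; under eq_bigr do rewrite pairing0l.
by rewrite sumr_const natz.
Qed.

Lemma fourier_inversion A v :
  \sum_g fourier A g * sgn (b g v) = #|W|%:Z * (v \in A)%:Z.
Proof.
under eq_bigr do rewrite big_distrl /=.
rewrite exchange_big /=.
transitivity (\sum_(w in A) if w == v then #|W|%:Z else 0).
  apply: eq_bigr => w _; rewrite -subr_eq0 -orthogonality.
  by apply: eq_bigr => g _; rewrite bDr pairingN sgnD.
have [v_A|v_A] := boolP (v \in A).
  rewrite (bigD1 v) //= eqxx big1 ?addr0 ?mulr1 // => w /andP[_ /negPf->] //.
by rewrite mulr0 big1 // => w w_A; case: eqP => // wv; rewrite -wv w_A in v_A.
Qed.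

Lemma parseval A : \sum_g fourier A g ^+ 2 = #|W|%:Z * #|A|%:Z.
Proof.
transitivity (\sum_(v in A) \sum_g fourier A g * sgn (b g v)).
  by rewrite exchange_big; apply: eq_bigr => g _; rewrite -big_distrr expr2.
under eq_bigr => v v_A do rewrite fourier_inversion v_A mulr1.
by rewrite sumr_const -mulr_natr natz.
Qed.

Section TwoIntersection.
Variables (A : {set W}) (beta : int).
Hypotheses (cardW : #|W| = (4 ^ 7)%N) (cardA : #|A| = 1290%N) (A0 : 0 \notin A)
  (two : forall g, g != 0 -> fourier A g = - 118%:Z \/ fourier A g = beta).

(** The two Fourier values -118 and beta off the origin satisfy the first two
    moment equations, which determine beta. *)
Lemma two_values g : g != 0 -> fourier A g = - 118%:Z \/ fourier A g = 10%:Z.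
Proof.
suff beta10 : beta = 10 by move=> nz_g; case: (two nz_g) => ->; [left | right].
have s1 : \sum_(h | h != 0) fourier A h = - 1290%:Z.
  have := fourier_inversion A 0; rewrite (negPf A0) mulr0 (bigD1 0) //=.
  rewrite fourier0 cardA pairing0r /sgn expr0 mulr1.
  under eq_bigr do rewrite pairing0r expr0 mulr1.
  by move: (\sum_(h | _) _) => s; lia.
have s2 := parseval A; rewrite (bigD1 0) //= fourier0 cardA cardW in s2.
have s3 : \sum_(h | h != 0) (fourier A h + 118%:Z) * (fourier A h - beta) = 0.
  by apply: big1 => h /two[->|->]; rewrite ?addNr ?mul0r // subrr mulr0.
have card_nz : #|[pred h : W | h != 0]| = (4 ^ 7).-1%N.
  by rewrite -cardW -(cardC1 0); apply: eq_card.
have E : \sum_(h | h != 0) (fourier A h + 118%:Z) * (fourier A h - beta) =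
   \sum_(h | h != 0) fourier A h ^+ 2 + (118%:Z - beta) * \sum_(h | h != 0) fourier A h
     - 118%:Z * beta * (4 ^ 7).-1%:Z.
  have -> : 118%:Z * beta * (4 ^ 7).-1%:Z = \sum_(h : W | h != 0) 118%:Z * beta.
    rewrite (eq_bigl (mem [pred h : W | h != 0])) //.
    by rewrite sumr_const card_nz -[in RHS]mulr_natr natz.
  rewrite big_distrr /= -sumrN -!big_split /=.
  by apply: eq_bigr => h _; ring.
have q7 : (4 ^ 7)%:Z = 128%:Z * 128%:Z by vm_compute.
have q7' : (4 ^ 7).-1%:Z = 128%:Z * 128%:Z - 1 by vm_compute.
move: s2 s3; rewrite E s1 q7 q7' expr2.
by move: (\sum_(h | _) _) => s2; lia.
Qed.

(** The nonzero vectors with Fourier value -118; over the 430-cap these are the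
    hyperplanes that meet it in 78 points. *)
Definition dual_set : {set W} := [set g | (g != 0) && (fourier A g == - 118%:Z)].

Lemma fourier_dual_set v :
  fourier A v = 10%:Z + 1280%:Z * (v == 0)%:Z - 128%:Z * (v \in dual_set)%:Z.
Proof.
rewrite inE; have [->|nz_v] := eqVneq v 0; first by rewrite fourier0 cardA.
by case: (two_values nz_v) => ->.
Qed.

Definition dual_fourier (v : W) : int := \sum_(g in dual_set) sgn (b g v).

(** The Fourier transform of the dual set is constant modulo 128. *)
Lemma dual_fourierE v :
  dual_fourier v = 10%:Z + 1280%:Z * (v == 0)%:Z - 128%:Z * (v \in A)%:Z.
Proof.
have := fourier_inversion A v; rewrite cardW.
under eq_bigr => g _ do rewrite fourier_dual_set mulrBl mulrDl.
rewrite sumrB big_split /= -big_distrr /= orthogonality cardW.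
have -> : \sum_g 1280%:Z * (g == 0)%:Z * sgn (b g v) = 1280%:Z.
  rewrite (bigD1 0) //= eqxx pairing0l big1 ?addr0 // => g /negPf->.
  by rewrite mulr0 mul0r.
have -> : \sum_g 128%:Z * (g \in dual_set)%:Z * sgn (b g v) =
    128%:Z * dual_fourier v.
  rewrite /dual_fourier [in RHS]big_mkcond big_distrr; apply: eq_bigr => g _ /=.
  by case: (g \in _); rewrite ?mulr1 // !mulr0 mul0r.
by case: (v == 0); case: (v \in A); lia.
Qed.

(** The Fourier transform of the part of the dual set where all the linear
    forms of vs take the value 1. *)
Definition dual_part (vs : seq W) (w : W) : int :=
  \sum_(g in dual_set | all (b g) vs) sgn (b g w).

Lemma dual_part_cons v vs w :
  2 * dual_part (v :: vs) w = dual_part vs w - dual_part vs (w + v).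
Proof.
rewrite /dual_part -sumrB big_distrr [RHS](bigID (fun g => b g v)) /=.
rewrite [X in _ = _ + X]big1 ?addr0 => [|g /andP[_ /negPf nb_v]]; last first.
  by rewrite bDr nb_v addbF subrr.
apply: eq_big => [g|g /and3P[_ b_v _]]; first by rewrite [_ && all _ _]andbC andbA.
by rewrite bDr b_v addbT /sgn; case: (b g w); rewrite /= ?expr0 ?expr1.
Qed.

(** Each linear form halves the modulus of the congruence. *)
Lemma dual_part_dvd vs w w' : (size vs <= 7)%N ->
  (2 ^+ (7 - size vs) %| dual_part vs w - dual_part vs w')%Z.
Proof.
elim: vs w w' => [|v vs IHvs] w w' sz.
  have part0 u : dual_part [::] u = dual_fourier u.
    by apply: eq_bigl => g; rewrite andbT.
  rewrite !part0 !dual_fourierE.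
  apply/dvdzP.
  exists (10%:Z * ((w == 0)%:Z - (w' == 0)%:Z) - ((w \in A)%:Z - (w' \in A)%:Z)).
  by rewrite (_ : 2 ^+ (7 - size [::]) = 128%:Z) //; ring.
have d1 := IHvs w (w + v) (ltnW sz); have d2 := IHvs w' (w' + v) (ltnW sz).
have := rpredB d1 d2; rewrite -!dual_part_cons -mulrBr -subnSK // exprS.
by rewrite dvdz_mul2l.
Qed.

(** A product of at most 6 linear forms, and at least one, takes the value 1 an
    even number of times on the dual set. *)
Lemma dual_parity vs : (0 < size vs <= 6)%N ->
  ~~ odd #|[set g in dual_set | all (b g) vs]|.
Proof.
case: vs => // v vs sz.
set S := [set g in dual_set | _].
have card_part : dual_part (v :: vs) 0 = #|S|%:Z.
  rewrite /dual_part (eq_bigl (mem S)).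
    rewrite (eq_bigr (fun=> 1)) => [|g _]; first by rewrite sumr_const natz.
    by rewrite pairing0r /sgn expr0.
  by move=> g; rewrite [RHS]inE.
have sz5 : (size vs <= 5)%N by case/andP: sz.
have /dvdzP[q] := dual_part_dvd 0 (0 + v) (leq_trans sz5 (isT : 5 <= 7)%N).
rewrite -dual_part_cons card_part.
have -> : (7 - size vs = (5 - size vs).+2)%N by lia.
rewrite !exprS => E; have {}E : #|S|%:Z = 2 * (q * 2 ^+ (5 - size vs)).
  by apply: (@mulfI _ (2 : int)) => //; rewrite E; ring.
by move: E; move: #|S| (q * _) => k u; lia.
Qed.

End TwoIntersection.
End Fourier.

(** * The dual set over a Hill cap *)

HB.instance Definition _ (U V : finZmodType) := Finite.on (U * V)%type.

Section NoLift.
Variables (K F : finFieldType) (zeta : K).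
Hypotheses (cardK : #|K| = (2 ^ 12)%N) (cardF : #|F| = (2 ^ 2)%N)
  (zetaE : zeta ^+ 12 = zeta ^+ 6 + zeta ^+ 4 + zeta + 1).
Let W : finZmodType := (K * F)%type.
Local Notation trF := (@trace_bit F 2).

(** The trace form of the space K * F, in which K * 0 is the hyperplane of the
    Hill cap. *)
Definition trace_pairing (g v : K * F) : bool :=
  tr (g.1 * v.1) (+) trF (g.2 * v.2).
Local Notation b := (trace_pairing : W -> W -> bool).

Lemma trace_pairingDl v : {morph b^~ v : g h / g + h >-> g (+) h}.
Proof.
move=> g h; rewrite /trace_pairing !mulrDl (trace_bitD cardK) (trace_bitD cardF).
by rewrite !addbA; congr (_ (+) _); rewrite -!addbA; congr (_ (+) _); rewrite addbC.
Qed.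

Lemma trace_pairingC g v : b g v = b v g.
Proof. by rewrite /trace_pairing mulrC [g.2 * _]mulrC. Qed.

Lemma trace_pairingDr g : {morph b g : v w / v + w >-> v (+) w}.
Proof.
by move=> v w; rewrite !(trace_pairingC g); apply: trace_pairingDl.
Qed.

Lemma trace_pairing_nondegenerate v : v != 0 -> exists g, b g v.
Proof.
case: v => x y; rewrite /trace_pairing -pair_eqE /= negb_and.
case: (eqVneq x 0) => [-> /= | nz_x _].
  case/(trace_bit_nondegenerate cardF) => c tr_c.
  by exists (0, c); rewrite /= mulr0 (trace_bit0 cardK).
have [a tr_a] := trace_bit_nondegenerate cardK nz_x.
by exists (a, 0); rewrite /= mul0r (trace_bit0 cardF) addbF.
Qed.
Let ndl := trace_pairing_nondegenerate.
Let Dl := trace_pairingDl.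
Let Dr := trace_pairingDr.

Lemma card_pairs : #|W| = (4 ^ 7)%N.
Proof. by rewrite card_prod cardK cardF -expnD -[4%N]/(2 ^ 2)%N -expnM. Qed.

Variables (A : {set W}) (beta : int).
Hypotheses (cardA : #|A| = 1290%N) (A0 : 0 \notin A)
  (two : forall g, g != 0 -> fourier b A g = - 118%:Z \/ fourier b A g = beta)
  (A_base : forall x, ((x, 0) \in A) = (x \in Oseq zeta))
  (A_infty : forall c, c != 0 -> fourier b A (0, c) = - 118%:Z).
Local Notation D := (dual_set b A).

Lemma fourier_fiber a : \sum_c fourier b A (a, c) =
  4%:Z * \sum_(x <- Oseq zeta) sgn (tr (a * x)).
Proof.
have sumF y : \sum_(c : F) sgn (trF (c * y)) = if y == 0 then 4%:Z else 0.
  rewrite sum_character => [|c c']; last by rewrite mulrDl (trace_bitD cardF).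
  have [->|nz_y] := eqVneq y 0; last first.
    by have /existsP-> := trace_bit_nondegenerate cardF nz_y.
  case: existsP => [[c]|_]; last by rewrite cardF.
  by rewrite mulr0 (trace_bit0 cardF).
rewrite /fourier exchange_big /=.
transitivity (\sum_(v in A) sgn (tr (a * v.1)) * (if v.2 == 0 then 4%:Z else 0)).
  apply: eq_bigr => v _; rewrite -sumF big_distrr; apply: eq_bigr => c _.
  by rewrite /trace_pairing sgnD.
transitivity (\sum_x \sum_y if (x, y) \in A then
    sgn (tr (a * x)) * (if y == 0 then 4%:Z else 0) else 0).
  by rewrite pair_bigA big_mkcond; apply: eq_bigr => -[x y] _.
have uO : uniq (Oseq zeta) by apply: (uniq_classes cardK zetaE) => //; apply/allP.
rewrite [RHS]big_distrr [RHS](big_uniq _ uO) [RHS]big_mkcond; apply: eq_bigr => x _.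
rewrite (bigD1 0) //= eqxx big1 ?addr0 => [|y /negPf->]; last first.
  by case: ifP; rewrite ?mulr0.
by rewrite A_base mulrC; case: ifP.
Qed.

(** Over a nonzero a there is exactly one element of the dual set if a is in T,
    and none otherwise. *)
Lemma dual_fiber a : a != 0 ->
  #|[set c | (a, c) \in D]| = (a \in Tseq zeta) :> nat.
Proof.
move=> nz_a; have sumD : \sum_c fourier b A (a, c) =
    40%:Z - 128%:Z * #|[set c | (a, c) \in D]|%:Z.
  transitivity (\sum_(c : F) (10%:Z - 128%:Z * ((a, c) \in D)%:Z)).
    apply: eq_bigr => c _.
    rewrite (fourier_dual_set Dl Dr ndl card_pairs cardA A0 two).
    by rewrite -pair_eqE /= (negPf nz_a) mulr0 addr0.
  rewrite sumrB sumr_const cardF -big_distrr /=; congr (_ - _ * _).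
  rewrite -sum1_card -natz natr_sum [RHS]big_mkcond /=; apply: eq_bigr => c _.
  by rewrite [c \in _]inE; case: ((a, c) \in _).
have := fourier_fiber a; rewrite sumD (hill_fourier cardK zetaE) //.
by case: ifP => _; lia.
Qed.

Lemma dual_fiber0 c : ((0, c) \in D) = (c != 0).
Proof.
rewrite inE -pair_eqE /= eqxx /=; have [//|nz_c] := eqVneq c 0.
by rewrite A_infty // eqxx.
Qed.

Lemma count_trace_bit4 : (\sum_(c : F | c != 0%R) trF c = 2)%N.
Proof.
have := sum_character (f := trF) (trace_bitD cardF).
have /existsP-> := trace_bit_surj cardF.
rewrite -big_enum sum_sgn -cardE cardF -sum1_count big_enum_cond => count2.
transitivity (\sum_(c : F | trF c) 1)%N; last first.
  by move: count2; rewrite (eq_bigl trF) //=; move: (bigop _ _ _) => k; lia.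
rewrite [RHS]big_mkcond [LHS]big_mkcond; apply: eq_bigr => c _.
by case: eqP => [->|_]; rewrite ?(trace_bit0 cardF) //=; case: trF.
Qed.

(** The trace of the second coordinate of the lift of a to the dual set. *)
Definition lift_bit (a : K) : bool := [exists c, ((a, c) \in D) && trF c].

Lemma lift_bitE a c : a != 0 -> (a, c) \in D -> lift_bit a = trF c.
Proof.
move=> nz_a ac_D; apply/existsP/idP => [[c' /andP[ac'_D]]|tr_c]; last first.
  by exists c; rewrite ac_D.
suff -> : c' = c by [].
have /card_le1_eqP : (#|[set c | (a, c) \in D]| <= 1)%N.
  by rewrite dual_fiber // leq_b1.
by apply; rewrite inE.
Qed.

(** Parity of the dual set for the linear form of (0, 1) and those of the
    vectors (x, 0). *)
Lemma lift_bit_parity xs : (size xs <= 5)%N ->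
  \sum_(a <- Tseq zeta) (lift_bit a)%:R * \prod_(x <- xs) (tr (a * x))%:R = 0 :> K.
Proof.
move=> sz_xs; pose vs : seq W := (0, 1) :: [seq (x, 0) | x <- xs].
have sz_vs : (0 < size vs <= 6)%N by rewrite /= size_map ltnS.
have := dual_parity Dl Dr ndl card_pairs cardA A0 two sz_vs.
set N := #|_|; have -> : N = (\sum_(a : K) \sum_(c : F)
    (((a, c) \in D) && trF c) * all (fun x => tr (a * x)%R) xs)%N.
  rewrite pair_bigA /N -sum1_card big_mkcond; apply: eq_bigr => -[a c] _ /=.
  rewrite inE /vs /= all_map.
  have -> : trace_pairing (a, c) (0, 1) = trF c.
    by rewrite /trace_pairing /= mulr0 mulr1 (trace_bit0 cardK).
  rewrite (eq_all (a2 := fun x => tr (a * x))) => [|x]; last first.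
    by rewrite /= /trace_pairing /= mulr0 (trace_bit0 cardF) addbF.
  by case: ((a, c) \in _); case: (trF c); case: (all _ _).
move=> even_sum.
pose fiber (a : K) : K := (\sum_(c : F) ((a, c) \in D) && trF c)%N%:R.
have sum0 : \sum_a fiber a * \prod_(x <- xs) (tr (a * x))%:R = 0.
  transitivity ((\sum_(a : K) \sum_(c : F)
      (((a, c) \in D) && trF c) * all (fun x => tr (a * x)%R) xs)%N%:R : K); last first.
    rewrite -(even_halfK even_sum) -mul2n natrM.
    by rewrite (pcharf0 (pchar_card2X cardK)) mul0r.
  rewrite natr_sum; apply: eq_bigr => a _.
  rewrite -big_distrl natrM /=; congr (_ * _).
  elim: (xs) => [|x s IHs]; first by rewrite big_nil.
  by rewrite big_cons IHs /=; case: (tr _); rewrite ?mul1r ?mul0r.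
rewrite -[RHS]sum0 big_uniq ?(uniq_classes cardK zetaE) //; last by apply/allP.
rewrite big_mkcond; apply: eq_bigr => a _ /=.
have fiberE : fiber a = (\sum_(c in [set c | (a, c) \in D]) trF c)%N%:R.
  rewrite /fiber [in RHS]big_mkcond; congr (_%:R); apply: eq_bigr => c _.
  by rewrite [c \in _]inE; case: ((a, c) \in _).
rewrite {}fiberE; have [->|nz_a] := eqVneq a 0.
  rewrite ifN; last first.
    apply/allpairsP => -[[r i] [_ _ /esym/eqP]] /=.
    by rewrite (negPf (zetaX_neq0 cardK zetaE _)).
  have -> : (\sum_(c in [set c | (0%R, c) \in D]) trF c = 2)%N.
    rewrite (eq_bigl (fun c => c != 0)) => [|c]; last by rewrite inE dual_fiber0.
    exact: count_trace_bit4.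
  by rewrite (pcharf0 (pchar_card2X cardK)) mul0r.
have := dual_fiber nz_a; case: ifP => _ /eqP.
  case/cards1P => c0 S1; rewrite S1 big_set1; congr (_%:R * _).
  rewrite (lift_bitE nz_a (c := c0)) //.
  by move/setP/(_ c0): S1; rewrite inE set11.
by rewrite cards_eq0 => /eqP->; rewrite big_set0 mul0r.
Qed.

(** If tr (c) = tr (y * a) for the elements (a, c) of the dual set with a nonzero,
    then its Fourier transform at (y, 1) is within 8 of its value 1290 at 0,
    instead of being 10 or -118. *)
Lemma no_hill_lift : False.
Proof.
have [y h_y] := low_degree_linear cardK zetaE lift_bit_parity.
pose v : W := (y, 1).
have nz_v : v != 0 by rewrite -pair_eqE /= oner_eq0 andbF.
have := dual_fourierE Dl Dr ndl card_pairs cardA A0 two 0.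
have := dual_fourierE Dl Dr ndl card_pairs cardA A0 two v.
rewrite (negPf nz_v) eqxx (negPf A0).
have : dual_fourier b A 0 - dual_fourier b A v <= 8%:Z.
  rewrite /dual_fourier -sumrB.
  apply: (@le_trans _ _ (\sum_(g : W | g.1 == 0) 2%:Z)).
    rewrite [leLHS]big_mkcond [leRHS]big_mkcond; apply: ler_sum => -[a c] _ /=.
    rewrite (pairing0r Dr); have [->|nz_a] := eqVneq a 0.
      by case: ifP => _ //; case: (b _ _); rewrite /sgn.
    case: ifP => // ac_D.
    suff -> : b (a, c) v = false by rewrite subrr.
    have a_T : a \in Tseq zeta.
      have := dual_fiber nz_a; case: (a \in _) => // /eqP.
      by rewrite cards_eq0 => /eqP/setP/(_ c); rewrite inE ac_D inE.
    rewrite /trace_pairing /= mulr1 mulrC -h_y // (lift_bitE nz_a ac_D).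
    by rewrite addbb.
  rewrite (eq_bigl (mem [set g : W | g.1 == 0])) => [|g]; last by rewrite [RHS]inE.
  rewrite sumr_const (_ : #|_| = 4%N) //.
  have -> : [set g : W | g.1 == 0] = [set (0, c) | c : F].
    apply/setP => -[a c]; rewrite inE; apply/eqP/imsetP => [/= ->|[c' _ [->]] //].
    by exists c.
  by rewrite card_imset ?cardF // => c c' [].
by case: (v \in A) => /=; lia.
Qed.

End NoLift.

(** * Existence of zeta, and the choice of the generator *)

Definition minpoly_bits : seq bool := rcons low12 true.

(** The product of two polynomials, not reduced. *)
Fixpoint mulp (s t : seq bool) : seq bool :=
  if s is a :: s' then xorp (if a then t else [::]) (false :: mulp s' t)
  else [::].

(** The quotient of X^n c by the modulus, padded to n coefficients: its
    coefficient of degree n - 1 - m is the leading bit of the residue of X^m c. *)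
Fixpoint quotient_bits (n : nat) (c : seq bool) : seq bool :=
  if n is n'.+1 then rcons (quotient_bits n' (mulx c)) (nth false c 11)
  else [::].

(** The quotient of X^4095 + 1 by the modulus; the leading bits of the residues
    of 1, X, ..., X^10 vanish, which leaves 4084 coefficients. *)
Definition cofactor4095 : seq bool := take 4084 (quotient_bits 4095 one12).

Lemma cofactor4095P : exists2 s, size s = 4083%N &
  mulp minpoly_bits (true :: s) = true :: rcons (nseq 4094 false) true.
Proof. by exists (behead cofactor4095); [|apply/eqP]; vm_compute. Qed.

Section Existence.
Variable K : finFieldType.
Hypothesis cardK : #|K| = (2 ^ 12)%N.
Let charK := pchar_card2X cardK.

Lemma ev_mulp (x : K) s t : ev x (mulp s t) = ev x s * ev x t.
Proof.
elim: s => [|a s IHs] /=; first by rewrite mul0r.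
rewrite (ev_xorp x charK) /= add0r IHs mulrDl mulrA; congr (_ + _).
by case: a; rewrite ?mul1r ?mul0r.
Qed.

Lemma ev_nseq_false (x : K) n : ev x (nseq n false) = 0.
Proof. by elim: n => //= n ->; rewrite mulr0 addr0. Qed.

(** The modulus times the cofactor vanishes at the 4095 nonzero elements of K,
    while the cofactor has degree 4083, so the modulus has a root. *)
Lemma zeta_exists :
  exists zeta : K, zeta ^+ 12 = zeta ^+ 6 + zeta ^+ 4 + zeta + 1.
Proof.
have [c sz_c cofP] := cofactor4095P.
pose q : {poly K} := Poly (map (fun a : bool => a%:R) (true :: c)).
have qE x : q.[x] = ev x (true :: c).
  rewrite horner_Poly; elim: (true :: c) => //= a s ->.
  by rewrite addrC mulrC.
have minpolyE x : ev x minpoly_bits = x ^+ 12 + (x ^+ 6 + x ^+ 4 + x + 1).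
  by rewrite /= !(mulr0, addr0, add0r, mulr1); ring.
have prodE x : x != 0 -> ev x minpoly_bits * q.[x] = 0.
  move=> nz_x; rewrite qE -ev_mulp cofP.
  rewrite -[ev _ _]/(true%:R + x * ev x (rcons (nseq 4094 false) true)).
  rewrite ev_rcons ev_nseq_false size_nseq add0r mul1r -exprS.
  apply: (mulfI nz_x); rewrite mulr0 mulrDr mulr1 -exprS.
  by rewrite [X in _ + X](_ : _ = x) ?addrr_pchar2 // -[RHS]expf_card cardK.
have nz_q : q != 0.
  apply/eqP => q0; have := qE 0; rewrite q0 horner0.
  by rewrite /= mul0r addr0 => /esym/eqP; rewrite oner_eq0.
have sz_q : (size q <= 4084)%N.
  by apply: leq_trans (size_Poly _) _; rewrite size_map /= sz_c leqnn.
have /allPn[x] : ~~ all (root q) (enum [set~ (0 : K)]).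
  apply/negP => q_roots; have := max_poly_roots nz_q q_roots (enum_uniq _).
  rewrite -cardE cardsC1 cardK => lt_q; have := leq_trans lt_q sz_q.
  by vm_compute.
rewrite mem_enum !inE => nz_x nroot_x; exists x.
have /eqP := prodE x nz_x; rewrite mulf_eq0 -[q.[x] == 0]/(root q x).
rewrite (negPf nroot_x) orbF.
by rewrite minpolyE -[X in _ + X](oppr_pchar2 charK) subr_eq0 => /eqP.
Qed.

End Existence.

Section Units.
Variable K : finFieldType.
Hypothesis cardK : #|K| = (2 ^ 12)%N.

(** The elements of <y^35> and of y^7 <y^35>, in terms of powers of y. *)
Definition hill_class (y x : K) : Prop :=
  exists i, x = y ^+ (35 * i) \/ x = y ^+ (7 + 35 * i).

Lemma hill_class_expr y k x : (k %% 5 = 1)%N -> hill_class (y ^+ k) x -> hill_class y x.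
Proof.
move=> k1 [i]; rewrite (divn_eq k 5) k1 -!exprM; set q := (k %/ 5)%N.
case=> ->; [exists ((q * 5 + 1) * i)%N; left | exists (i + q + 5 * q * i)%N; right];
  by congr (_ ^+ _); lia.
Qed.

Lemma hill_classP zeta x : zeta ^+ 12 = zeta ^+ 6 + zeta ^+ 4 + zeta + 1 ->
  hill_class zeta x <-> x \in Oseq zeta.
Proof.
move=> zetaE; have mem_O e : (zeta ^+ e \in Oseq zeta) = (e %% 35 \in [:: 0; 7])%N.
  by apply: (mem_classes cardK zetaE); apply/allP.
split=> [[i [->|->]]|]; rewrite ?mem_O; first by rewrite mulnC modnMl.
  by rewrite addnC mulnC modnMDl.
case/allpairsP => -[r i] [r_in _ ->]; exists i.
by move: r_in; rewrite !inE => /orP[]/eqP-> /=; [left | right].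
Qed.

(** Every generator z defines the same set as some root zeta of the modulus: a
    suitable Frobenius conjugate zeta of any root has z = zeta^k with k = 1
    modulo 5, and 7 k is then 7 modulo 35. *)
Lemma hill_class_generator z : 4095.-primitive_root z ->
  exists zeta, zeta ^+ 12 = zeta ^+ 6 + zeta ^+ 4 + zeta + 1 /\
    forall x, hill_class z x <-> hill_class zeta x.
Proof.
move=> prim_z; have [zeta0 zeta0E] := zeta_exists cardK.
have nz_z : z != 0.
  apply/eqP => z0; have := prim_expr_order prim_z; rewrite z0 expr0n.
  by move=> /esym/eqP; rewrite oner_eq0.
have [k0 _ zE] := zeta_log cardK zeta0E nz_z.
have [j k0j] : exists j, (k0 * 2 ^ j %% 5 = 1)%N.
  have k0_5 : (k0 %% 5 != 0)%N.
    apply/eqP => /eqP/dvdnP[k k0E].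
    have : z ^+ 819 = 1.
      rewrite zE k0E -exprM -mulnA -[(5 * 819)%N]/4095%N mulnC exprM.
      by rewrite (zeta_order cardK zeta0E) expr1n.
    by move/eqP; rewrite -(prim_order_dvd prim_z) gtnNdvd.
  move: k0_5 (ltn_pmod k0 (isT : 0 < 5)%N).
  case: (k0 %% 5)%N (fun j => esym (modnMml k0 (2 ^ j) 5)) => [|[|[|[|[|r]]]]] // kE _ _.
  - by exists 0%N; rewrite kE.
  - by exists 3%N; rewrite kE.
  - by exists 1%N; rewrite kE.
  - by exists 2%N; rewrite kE.
(* The conjugate of zeta0 by the inverse of the j-th power of Frobenius. *)
pose zeta := zeta0 ^+ (2 ^ (12 * j - j)).
have zeta0_j : zeta0 = zeta ^+ (2 ^ j).
  rewrite /zeta -exprM -expnD subnK; last by rewrite leq_pmull.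
  elim: (j) => [|i IHi]; rewrite ?expr1 // mulnS expnD mulnC exprM.
  by rewrite -cardK -IHi expf_card.
have zetaE : zeta ^+ 12 = zeta ^+ 6 + zeta ^+ 4 + zeta + 1.
  rewrite /zeta -!exprM ![(2 ^ _ * _)%N]mulnC ![in LHS]exprM zeta0E.
  by rewrite !(expr2n_additive cardK) expr1n -!exprM.
have zE' : z = zeta ^+ (k0 * 2 ^ j) by rewrite zE zeta0_j -exprM mulnC.
have [l zeta_l] : exists l, zeta = z ^+ l.
  have zeta1 : zeta ^+ 4095 = 1 by rewrite (zeta_order cardK zetaE).
  by have [i ->] := prim_rootP prim_z zeta1; exists i.
exists zeta; split=> // x; split.
  by rewrite zE'; apply: hill_class_expr.
rewrite zeta_l; apply: hill_class_expr.
have : z ^+ 1 == z ^+ (l * (k0 * 2 ^ j)) by rewrite exprM -zeta_l -zE'.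
rewrite (eq_prim_root_expr prim_z) => /eqP/(congr1 (modn^~ 5%N)).
by rewrite !modn_dvdm // -modnMmr k0j muln1.
Qed.

End Units.

(** * Coordinates adapted to a hyperplane *)

Lemma span_closed (F : fieldType) (V : vectType F) (P : V -> Prop) (s : seq V) :
  P 0 -> (forall u v, P u -> P v -> P (u + v)) -> (forall a v, P v -> P (a *: v)) ->
  {in s, forall v, P v} -> forall v, v \in <<s>>%VS -> P v.
Proof.
move=> P0 PD PZ Ps v; rewrite -[s]/(tval (in_tuple s)) => /coord_span->.
by apply: big_ind => // i _; apply/PZ/Ps; rewrite mem_nth.
Qed.

Lemma card_vspace_finvect (F : finFieldType) (U : vectType F) (P : {vspace U}) :
  #|[set v : finvect_type U | (v : U) \in P]| = (#|F| ^ \dim P)%N.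
Proof.
rewrite cardsE; case: U P => T cT P.
exact: (@card_vspace F (finvect_type (Vector.Pack cT)) cT P).
Qed.

Lemma card_finvect (F : finFieldType) (U : vectType F) :
  #|finvect_type U| = (#|F| ^ \dim {:U})%N.
Proof.
rewrite -(card_vspace_finvect (fullv : {vspace U})) -cardsT.
by apply: eq_card => v; rewrite !inE memvf.
Qed.

Section Coordinates.
Variables (F : finFieldType) (V : vectType F) (L : fieldExtType F).
Hypotheses (cardF : #|F| = 4%N) (dimV : \dim {:V} = 7%N) (dimL : \dim {:L} = 6%N).
Variables (H : {vspace V}) (C : {set point V}).
Hypothesis hypH : hyperplane H.
Variables (s : {rmorphism F -> F}) (f : {linear subvs_of H -> L | s \; *:%R}).
Variables (g : L -> subvs_of H) (v0 : V).
Hypotheses (fK : cancel f g) (gK : cancel g f) (v0_notin : v0 \notin H).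
Let K : finFieldType := finvect_type L.
Let W : finZmodType := (K * F)%type.

Lemma cardF2 : #|F| = (2 ^ 2)%N. Proof. exact: cardF. Qed.

Lemma card_ext : #|K| = (2 ^ 12)%N.
Proof. by rewrite card_finvect dimL cardF -[4%N]/(2 ^ 2)%N -expnM. Qed.

(** The inverse of the field automorphism s. *)
Definition s_inv : F -> F := invF (fmorph_inj s).

Lemma s_invK : cancel s_inv s.
Proof. exact: f_invF. Qed.

Lemma s_invD : {morph s_inv : c d / c + d}.
Proof. by move=> c d; apply: (fmorph_inj s); rewrite rmorphD !s_invK. Qed.

Lemma gD : {morph g : x y / x + y}.
Proof. by move=> x y; apply: (can_inj fK); rewrite linearD !gK. Qed.

Lemma gZ a x : g (s a *: x) = a *: g x.
Proof. by apply: (can_inj fK); rewrite linearZ /= !gK. Qed.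

(** Scalar multiplication on K * F. *)
Definition scaleW (a : F) (w : W) : W := (a *: (w.1 : L), a * w.2).

(** Coordinates with first factor the hyperplane H, identified with L by the
    semilinear map f. The second factor is twisted by the inverse of s, so that
    the whole map is semilinear. *)
Definition coord_map (w : W) : finvect_type V := vsval (g w.1) + s_inv w.2 *: v0.

Lemma coord_mapD : {morph coord_map : w w' / w + w' >-> w + w' :> V}.
Proof.
by move=> w w'; rewrite /coord_map gD s_invD scalerDl linearD addrACA.
Qed.

Lemma coord_mapZ a w : coord_map (scaleW (s a) w) = a *: (coord_map w : V).
Proof.
rewrite /coord_map /= gZ linearZ scalerDr scalerA; congr (_ + _ *: _).
by apply: (fmorph_inj s); rewrite rmorphM !s_invK.
Qed.

Lemma s_inv_eq0 c : (s_inv c == 0) = (c == 0).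
Proof. by rewrite -(fmorph_eq0 s) s_invK. Qed.

Lemma coord_mapH w : ((coord_map w : V) \in H) = (w.2 == 0).
Proof.
rewrite /coord_map rpredDl ?subvsP // -s_inv_eq0.
have [->|nz_c] := eqVneq (s_inv w.2) 0; first by rewrite scale0r mem0v.
by rewrite rpredZeq (negPf nz_c) (negPf v0_notin).
Qed.

Lemma coord_map_inj : injective coord_map.
Proof.
move=> w w' E; apply/eqP; rewrite -subr_eq0; apply/eqP; set d := w - w'.
have d0 : coord_map d = 0 :> V.
  by apply: (addIr (coord_map w' : V)); rewrite -coord_mapD subrK add0r E.
have d2 : d.2 = 0 by apply/eqP; rewrite -coord_mapH d0 mem0v.
have s_inv0 : s_inv 0 = 0 by apply/eqP; rewrite s_inv_eq0.
have gd : vsval (g d.1) = 0.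
  by rewrite -[RHS]d0 /coord_map d2 s_inv0 scale0r addr0.
have g0 : g 0 = 0 by apply: (can_inj fK); rewrite gK linear0.
have d1 : d.1 = 0.
  by apply: (can_inj gK); rewrite g0; apply: val_inj; rewrite [LHS]gd.
by rewrite [d]surjective_pairing d1 d2.
Qed.

Lemma coord_map_bij : bijective coord_map.
Proof.
apply: inj_card_bij coord_map_inj _.
by rewrite card_prod !card_finvect dimV dimL -expnSr.
Qed.

(** The coordinates of the nonzero vectors on the points of C. *)
Definition cap_vectors : {set W} :=
  [set w | [exists P in C, val P == <[coord_map w : V]>%VS]].
Local Notation A := cap_vectors.

Lemma card_point_vectors (P : point V) :
  #|[set w | val P == <[coord_map w : V]>%VS]| = 3%N.
Proof.
have dimP : \dim (val P) = 1%N by apply/eqP; exact: valP P.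
pose B := [set v : finvect_type V | (v : V) \in val P] :\ 0.
transitivity #|coord_map @^-1: B|.
  apply: eq_card => w; rewrite !inE; apply/eqP/andP => [PE|[nz_w w_P]].
    rewrite PE memv_line; split=> //; apply/eqP => w0.
    by move: dimP; rewrite PE dim_vline w0 eqxx.
  by apply/esym/eqP; rewrite eqEdim -memvE w_P dimP dim_vline nz_w.
rewrite on_card_preimset; last by case: coord_map_bij => h hK Kh; exists h.
have := card_vspace_finvect (val P); rewrite dimP cardF (cardsD1 0) inE mem0v.
by case.
Qed.

Lemma card_cap_vectors (U : {vspace V}) :
  #|[set w in A | (coord_map w : V) \in U]| = (3 * #|Defs.section U C|)%N.
Proof.
transitivity (\sum_(w : W) \sum_(P in Defs.section U C)
    (val P == <[coord_map w : V]>%VS))%N.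
  rewrite -sum1_card big_mkcond; apply: eq_bigr => w _.
  rewrite !inE; case: ifP => [/andP[/existsP[P /andP[P_C /eqP PE]] w_U]|nw].
    have P_sec : P \in Defs.section U C by rewrite inE P_C PE -memvE.
    rewrite (bigD1 P P_sec) PE eqxx big1 // => Q /andP[_ neQ].
    by rewrite -PE (inj_eq val_inj) (negPf neQ).
  rewrite big1 // => P; rewrite inE => /andP[P_C P_U].
  case: eqP => // PE; move: nw; rewrite memvE -PE P_U andbT => /existsP[].
  by exists P; rewrite P_C PE eqxx.
rewrite exchange_big /= (eq_bigr (fun=> 3%N)) => [|P _].
  by rewrite sum_nat_const mulnC.
rewrite -(card_point_vectors P) -sum1_card [RHS]big_mkcond.
by apply: eq_bigr => w _; rewrite inE; case: eqP.
Qed.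

Lemma cap_vectorsP w :
  reflect (exists2 P, P \in C & val P = <[coord_map w : V]>%VS) (w \in A).
Proof.
rewrite inE; apply: (iffP existsP) => [[P /andP[P_C /eqP PE]]|[P P_C PE]].
  by exists P.
by exists P; rewrite P_C PE eqxx.
Qed.

Lemma cap_vectors0 : 0 \notin A.
Proof.
apply/cap_vectorsP => -[P _ P0]; have /eqP := valP P; rewrite /= in P0 *.
rewrite P0 dim_vline => /eqP; rewrite eqb1 => /negP[]; apply/eqP.
by apply: (addIr (coord_map 0 : V)); rewrite -coord_mapD !add0r.
Qed.

Lemma s_surj a : exists a', a = s a'.
Proof. by exists (s_inv a); rewrite s_invK. Qed.

Lemma cap_vectorsZ a w : a != 0 -> (scaleW a w \in A) = (w \in A).
Proof.
have [a' ->] := s_surj a; rewrite fmorph_eq0 => nz_a.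
rewrite !inE; apply: eq_existsb => P; congr (_ && (_ == _)).
rewrite coord_mapZ; apply/eqP; rewrite eqEsubv -!memvE.
by rewrite memvZ ?memv_line // -{1}(scalerK nz_a (coord_map w : V)) memvZ ?memv_line.
Qed.

Section Hyperplanes.
Local Notation b := (@trace_pairing K F).

Lemma scaleWD a a' w : scaleW (a + a') w = scaleW a w + scaleW a' w.
Proof. by rewrite /scaleW scalerDl mulrDl. Qed.

Lemma scaleWDr a w w' : scaleW a (w + w') = scaleW a w + scaleW a w'.
Proof. by rewrite /scaleW scalerDr mulrDr. Qed.

Lemma scaleWA a a' w : scaleW a (scaleW a' w) = scaleW (a * a') w.
Proof. by rewrite /scaleW scalerA mulrA. Qed.

Lemma scaleW1 w : scaleW 1 w = w.
Proof. by case: w => x c; rewrite /scaleW scale1r mul1r. Qed.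

Lemma scaleW0 w : scaleW 0 w = 0.
Proof. by rewrite /scaleW scale0r mul0r. Qed.

Lemma scaleWK a : a != 0 -> cancel (scaleW a) (scaleW a^-1).
Proof. by move=> nz_a w; rewrite scaleWA mulVf // scaleW1. Qed.

(** The vectors all of whose scalar multiples are orthogonal to g0. *)
Definition kernel (g0 : W) : {set W} := [set w | [forall a, ~~ b g0 (scaleW a w)]].

Let Dl := trace_pairingDl card_ext cardF2.
Let Dr := trace_pairingDr card_ext cardF2.
Let nd := trace_pairing_nondegenerate card_ext cardF2.

Lemma card_setE (B : {set W}) : #|B|%:Z = \sum_w (w \in B)%:Z.
Proof.
rewrite -sum1_card -natz natr_sum big_mkcond; apply: eq_bigr => w _.
by case: (w \in B).
Qed.

(** The character sum over a set closed under scaling counts its elements in the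
    kernel: sum over the scalars first. *)
Lemma fourier_kernel (B : {set W}) (g0 : W) :
  (forall a w, a != 0 -> (scaleW a w \in B) = (w \in B)) ->
  4%:Z * #|[set w in B | w \in kernel g0]|%:Z = #|B|%:Z + 3%:Z * fourier b B g0.
Proof.
move=> BZ; transitivity (\sum_(a : F) \sum_(w in B) sgn (b g0 (scaleW a w))).
  rewrite exchange_big /= card_setE big_distrr [RHS]big_mkcond.
  apply: eq_bigr => w _; rewrite !inE; case: (w \in B) => /=; last by rewrite mulr0.
  rewrite (sum_character (f := fun a : F => b g0 (scaleW a w))); last first.
    by move=> a a'; rewrite scaleWD Dr.
  by rewrite -negb_exists; case: [exists a, _]; rewrite ?cardF.
rewrite (bigD1 0) //=; congr (_ + _).
  by under eq_bigr do rewrite scaleW0 (pairing0r Dr); rewrite sumr_const natz.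
have scale_sum a : a != 0 -> \sum_(w in B) sgn (b g0 (scaleW a w)) = fourier b B g0.
  move=> nz_a; rewrite /fourier [RHS](reindex_inj (can_inj (scaleWK nz_a))).
  by apply: eq_bigl => w; rewrite BZ.
under eq_bigr => a nz_a do rewrite scale_sum //.
rewrite (eq_bigl (mem [set~ (0 : F)])) => [|a]; last by rewrite /= !inE.
by rewrite sumr_const cardsC1 cardF -mulr_natl.
Qed.

Lemma card_kernel g0 : g0 != 0 -> #|kernel g0| = (4 ^ 6)%N.
Proof.
move=> nz_g; have := @fourier_kernel setT g0.
have -> : fourier b setT g0 = 0.
  transitivity (\sum_(w : W) sgn (b g0 w)); first by apply: eq_bigl => w; rewrite inE.
  have [w gw] := nd nz_g; rewrite (sum_character (Dr g0)) ifT //.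
  by apply/existsP; exists w; rewrite trace_pairingC.
have -> : [set w in setT | w \in kernel g0] = kernel g0.
  by apply/setP=> w; rewrite !inE.
rewrite cardsT (card_pairs card_ext cardF2) mulr0 addr0 => H4.
apply/eqP; rewrite -(eqn_pmul2l (isT : 0 < 4)%N) -expnS -eqz_nat PoszM H4 //.
by move=> a w nz_a; rewrite !inE.
Qed.

Lemma kernelD g0 : {in kernel g0 &, forall w w', w + w' \in kernel g0}.
Proof.
move=> w w'; rewrite !inE => /forallP kw /forallP kw'; apply/forallP => a.
by rewrite scaleWDr Dr (negPf (kw a)) (negPf (kw' a)).
Qed.

Lemma kernelZ g0 a w : w \in kernel g0 -> scaleW a w \in kernel g0.
Proof.
by rewrite !inE => /forallP kw; apply/forallP => a'; rewrite scaleWA.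
Qed.

(** The hyperplane of V with coordinates in the kernel of g0. *)
Definition kernel_space (g0 : W) : {vspace V} :=
  <<[seq (coord_map w : V) | w <- enum (kernel g0)]>>%VS.

Lemma mem_kernel_space g0 w :
  ((coord_map w : V) \in kernel_space g0) = (w \in kernel g0).
Proof.
apply/idP/idP => [w_in|w_ker]; last first.
  by apply: memv_span; apply/mapP; exists w; rewrite ?mem_enum.
pose P (v : V) := exists2 w', w' \in kernel g0 & v = coord_map w' :> V.
suff Pw : P (coord_map w) by case: Pw => w' w'_ker /coord_map_inj->.
rewrite /kernel_space in w_in.
refine (@span_closed F V P _ _ _ _ _ (coord_map w) w_in).
- exists 0; first rewrite inE.
    by apply/forallP => a; rewrite /scaleW scaler0 mulr0 (pairing0r Dr).
  by apply: (addIr (coord_map 0 : V)); rewrite -coord_mapD !add0r.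
- by move=> _ _ [u u_k ->] [v v_k ->]; exists (u + v); rewrite ?kernelD ?coord_mapD.
- by move=> a _ [u u_k ->]; exists (scaleW (s a) u); rewrite ?kernelZ ?coord_mapZ.
by move=> _ /mapP[u u_k ->]; exists u => //; rewrite mem_enum in u_k.
Qed.

Lemma kernel_space_hyperplane g0 : g0 != 0 -> hyperplane (kernel_space g0).
Proof.
move=> nz_g; rewrite /hyperplane dimV; congr S.
apply/eqP; rewrite -(eqn_exp2l _ _ (isT : 1 < 4)%N) -(card_kernel nz_g) -cardF.
rewrite -card_vspace_finvect -(on_card_preimset (f := coord_map)); last first.
  by case: coord_map_bij => h hK Kh; exists h.
by apply/eqP/eq_card => w; rewrite inE inE mem_kernel_space.
Qed.

Hypothesis cardC : #|C| = 430%N.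

Lemma card_cap : #|A| = 1290%N.
Proof.
have -> : A = [set w in A | (coord_map w : V) \in fullv].
  by apply/setP => w; rewrite [in RHS]inE memvf andbT.
rewrite card_cap_vectors (_ : Defs.section _ _ = C) ?cardC //.
by apply/setP => P; rewrite inE subvf andbT.
Qed.

Lemma fourier_cap g0 :
  fourier b A g0 = 4%:Z * #|Defs.section (kernel_space g0) C|%:Z - 430%:Z.
Proof.
have := fourier_kernel g0 cap_vectorsZ; rewrite card_cap.
have -> : [set w in A | w \in kernel g0] =
    [set w in A | (coord_map w : V) \in kernel_space g0].
  by apply/setP => w; rewrite !inE mem_kernel_space inE.
by rewrite card_cap_vectors; move: #|_| (fourier _ _ _) => k x; lia.
Qed.

Variable zeta : K.
Hypothesis zetaE : zeta ^+ 12 = zeta ^+ 6 + zeta ^+ 4 + zeta + 1.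
Hypothesis baseA : forall x : K, ((x, 0) \in A) = (x \in Oseq zeta).

Lemma card_base : #|[set w in A | w.2 == 0]| = 234%N.
Proof.
have uO : uniq (Oseq zeta) by apply: (uniq_classes card_ext zetaE) => //; apply/allP.
rewrite -(size_Oseq zeta) -(card_uniqP uO).
rewrite -(card_imset _ (f := fun x : K => (x, 0 : F) : W)).
  apply: eq_card => -[x c]; rewrite [LHS]inE.
  apply/andP/imsetP => /= [[xc_A /eqP c0]|[y y_O [-> ->]]].
    by exists x; rewrite ?c0 // -baseA -c0.
  by rewrite baseA eqxx.
by move=> x y [].
Qed.

Lemma card_section_base : #|Defs.section H C| = 78%N.
Proof.
have := card_cap_vectors H.
have -> : [set w in A | (coord_map w : V) \in H] = [set w in A | w.2 == 0].
  by apply/setP => w; rewrite !inE coord_mapH.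
by rewrite card_base; lia.
Qed.

Lemma fourier_infty c : c != 0 -> fourier b A (0, c) = - 118%:Z.
Proof.
move=> nz_c; have := fourier_kernel (0, c) cap_vectorsZ; rewrite card_cap.
have -> : [set w in A | w \in kernel (0, c)] = [set w in A | w.2 == 0].
  apply/setP => w; rewrite !inE; congr (_ && _); rewrite /trace_pairing /=.
  apply/forallP/eqP => [ker_w|w2 a]; last first.
    by rewrite w2 !mulr0 mul0r (trace_bit0 card_ext) (trace_bit0 cardF2).
  apply/eqP; apply: contraT => nz_w; have [a] := trace_bit_nondegenerate cardF2 nz_w.
  have := ker_w (a / c); rewrite mul0r (trace_bit0 card_ext) /=.
  by rewrite mulrA mulrCA divff // mulr1 => /negPf->.
by rewrite card_base; move: (fourier _ _ _) => x; lia.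
Qed.

(** A 430-set whose section by H has the coordinates of a Hill cap does not have
    two intersection sizes. *)
Lemma no_hill_section : ~ two_intersection_sizes C.
Proof.
case=> k [l [_ sizes]].
have [k' sizes'] : exists k', forall U, hyperplane U ->
    #|Defs.section U C| = 78%N \/ #|Defs.section U C| = k'.
  have secE U : hyperplane U -> #|Defs.section U C| = k \/ #|Defs.section U C| = l.
    by move=> hU; apply/sizes; exists U.
  have := secE _ hypH; rewrite card_section_base => -[Dk|Dl'].
    by exists l => U /secE; rewrite -Dk.
  by exists k => U /secE; rewrite -Dl'; case; [right | left].
apply: (@no_hill_lift K F zeta card_ext cardF2 zetaE A (4%:Z * k'%:Z - 430%:Z)).
- exact: card_cap.
- exact: cap_vectors0.
- move=> g0 /kernel_space_hyperplane/sizes'; rewrite fourier_cap.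
  by case=> ->; [left | right].
- exact: baseA.
exact: fourier_infty.
Qed.

End Hyperplanes.
End Coordinates.

(** * The sections equivalent to the Hill cap *)

Section HillCap.
Variables (F : finFieldType) (L : fieldExtType F).
Hypotheses (cardF : #|F| = 4%N) (dimL : \dim {:L} = 6%N).
Let K : finFieldType := finvect_type L.
Variable z : {unit K}.
Hypothesis z_gen : generator [set: {unit K}] z.
Local Notation zK := (FinRing.uval z : K).

Lemma generator_primitive : 4095.-primitive_root zK.
Proof.
have cardK := card_ext cardF dimL.
have ord_z : #[z]%g = 4095%N.
  by rewrite orderE -(eqP z_gen) card_finField_unit cardK.
have zX m : (zK ^+ m == 1) = (4095 %| m)%N.
  by rewrite -FinRing.val_unitX -(FinRing.val_unit1 K) val_eqE -order_dvdn ord_z.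
have primesE : primes 4095 = [:: 3; 5; 7; 13]%N by vm_compute.
refine (primitive_root_primes (isT : 0 < 4095)%N _ _); first by apply/eqP; rewrite zX.
by rewrite primesE => p; rewrite zX !inE => /or4P[]/eqP->; vm_compute.
Qed.

Lemma hill_vectorsP (x : K) :
  (exists2 y, y \in hill_vectors z & x = FinRing.uval y) <-> hill_class zK x.
Proof.
split=> [[y y_hill ->]|[i xE]].
  move: y_hill; rewrite inE.
  case/orP=> [/cycleP[i ->]|/lcosetP[_ /cycleP[i ->] ->]]; exists i.
    by left; rewrite !FinRing.val_unitX exprM.
  by right; rewrite FinRing.val_unitM !FinRing.val_unitX exprD exprM.
case: xE => ->; [exists ((z ^+ 35) ^+ i)%g | exists (z ^+ 7 * (z ^+ 35) ^+ i)%g].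
- by rewrite inE mem_cycle.
- by rewrite !FinRing.val_unitX exprM.
- by rewrite inE orbC mem_lcoset mulKg mem_cycle.
by rewrite FinRing.val_unitM !FinRing.val_unitX exprD exprM.
Qed.

(** Nonzero scalars are cube roots of unity, hence powers of z^35. *)
Lemma hill_classZ (k : F) (x : L) : k != 0 -> hill_class zK x -> hill_class zK (k *: x).
Proof.
move=> nz_k; have cardK := card_ext cardF dimL.
have prim_z := generator_primitive.
have k3 : k ^+ 3 = 1.
  by apply: (mulfI nz_k); rewrite mulr1 -exprS -{2}(expf_card k) cardF.
have [i kE] : exists i, (k%:A : K) = zK ^+ (35 * i).
  have k3A : (k%:A : K) ^+ 3 = 1.
    by rewrite -[k%:A]/(in_alg L k) -rmorphXn k3 rmorph1.
  have kA : (k%:A : K) ^+ 4095 = 1.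
    by rewrite -[4095%N]/(3 * 1365)%N exprM k3A expr1n.
  have [e kE] := prim_rootP prim_z kA.
  have : (4095 %| e * 3)%N by rewrite (prim_order_dvd prim_z) exprM -kE k3A.
  rewrite -[4095%N]/(1365 * 3)%N dvdn_pmul2r // => /dvdnP[q eE].
  by exists (q * 39)%N; rewrite kE eE mulnCA.
have -> : k *: x = (k%:A : K) * x by rewrite -[RHS]/((k%:A : L) * x) mulr_algl.
by case=> j [->|->]; exists (i + j)%N; [left | right];
  rewrite kE -exprD mulnDr // addnCA.
Qed.

End HillCap.

Lemma point_line (F : finFieldType) (U : vectType F) (u : U) : u != 0 ->
  exists P : point U, val P = <[u]>%VS.
Proof.
move=> nz_u; have dim1 : \dim <[u]> == 1%N by rewrite dim_vline nz_u.
by exists (exist _ <[u]>%VS dim1).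
Qed.

Lemma point_eq_line (F : finFieldType) (U : vectType F) (P : point U) (u : U) :
  u != 0 -> u \in val P -> val P = <[u]>%VS.
Proof.
move=> nz_u u_P; apply/esym/eqP; rewrite eqEdim -memvE u_P dim_vline nz_u.
by rewrite (eqP (valP P)).
Qed.

(** A point of H spanned by u belongs to the section when u spans a point of C
    in the whole space. *)
Lemma mem_section_in (F : finFieldType) (V : vectType F) (H : {vspace V})
    (C : {set point V}) (P : point (subvs_of H)) (u : subvs_of H) :
  val P = <[u]>%VS ->
  P \in section_in H C <-> exists2 Q, Q \in C & val Q = <[vsval u]>%VS.
Proof.
move=> PE; have imE : (linfun vsval @: val P)%VS = <[vsval u]>%VS.
  by rewrite PE limg_line lfunE.
rewrite inE imE; split=> [/existsP[Q /andP[]]|[Q Q_C QE]].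
  by rewrite inE => /andP[Q_C _] /eqP QE; exists Q.
by apply/existsP; exists Q; rewrite inE Q_C QE eqxx -memvE subvsP.
Qed.

(** Projective equivalence read on vectors: g x spans a point of C exactly when x
    is a vector of the Hill cap. *)
Lemma hill_base (F : finFieldType) (cardF : #|F| = 4%N) (V : vectType F)
    (L : fieldExtType F) (dimL : \dim {:L} = 6%N)
    (z : {unit finvect_type L}) (z_gen : generator [set: {unit finvect_type L}] z)
    (C : {set point V}) (H : {vspace V}) (s : {rmorphism F -> F})
    (f : {linear subvs_of H -> L | s \; *:%R}) (g : L -> subvs_of H) :
  cancel f g -> cancel g f ->
  (forall Q : point L, Q \in hill_cap z <->
    exists2 P : point (subvs_of H), P \in section_in H C &
      forall w : L, w \in val Q <-> exists2 u, u \in val P & w = f u) ->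
  forall x : L, (exists2 P, P \in C & val P = <[vsval (g x)]>%VS) <->
    hill_class (FinRing.uval z : finvect_type L) x.
Proof.
move=> fK gK equiv x; split=> [[P P_C PE]|x_hill].
  have nz_u : g x != 0.
    apply/eqP => g0; have := eqP (valP P); rewrite PE g0 dim_vline.
    by rewrite raddf0 eqxx.
  have nz_x : x != 0.
    by apply: contraNneq nz_u => ->; rewrite -(fK 0) linear0.
  have [P0 P0E] := point_line nz_u; have [Q QE] := point_line nz_x.
  have : Q \in hill_cap z.
    apply/equiv; exists P0; first by apply/(mem_section_in _ P0E); exists P.
    move=> w; rewrite QE P0E; split=> [/vlineP[k ->]|[_ /vlineP[k ->] ->]].
      exists (s_inv s k *: g x); first by rewrite memvZ ?memv_line.
      by rewrite linearZ /= s_invK gK.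
    by rewrite linearZ /= gK memvZ ?memv_line.
  rewrite inE => /existsP[y /andP[y_hill /eqP Qy]].
  have /vlineP[k xE] : x \in <[FinRing.uval y : L]>%VS by rewrite -Qy QE memv_line.
  have nz_k : k != 0 by apply: contraNneq nz_x => k0; rewrite xE k0 scale0r.
  rewrite xE; apply: (hill_classZ cardF dimL z_gen nz_k).
  by apply/hill_vectorsP; exists y.
have /hill_vectorsP[y y_hill xE] := x_hill.
have nz_x : x != 0 by rewrite xE -unitfE; exact: (valP y).
have [Q QE] := point_line nz_x.
have : Q \in hill_cap z.
  by rewrite inE; apply/existsP; exists y; rewrite y_hill QE xE eqxx.
case/equiv => P P_sec /(_ x); rewrite QE memv_line => -[/(_ isT)[u u_P xu] _].
have uE : u = g x by rewrite xu fK.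
have nz_u : u != 0 by apply: contraNneq nz_x => u0; rewrite xu u0 linear0.
have /(mem_section_in C) := point_eq_line nz_u u_P.
by rewrite -uE => PE; apply/PE.
Qed.

Lemma no_hill_hyperplane_section (F : finFieldType) (cardF : #|F| = 4%N)
    (V : vectType F) (dimV : \dim {:V} = 7%N)
    (L : fieldExtType F) (dimL : \dim {:L} = 6%N)
    (z : {unit finvect_type L})
    (z_prim : generator [set: {unit finvect_type L}] z) (C : {set point V}) :
  #|C| = 430%N -> two_intersection_sizes C ->
  ~ exists H : {vspace V},
      hyperplane H /\ projectively_equivalent (section_in H C) (hill_cap z).
Proof.
move=> cardC sizes [H [hypH [s [f [[g fK gK] equiv]]]]].
have cardK := card_ext cardF dimL.
have [v0 v0_notin] : exists v0, v0 \notin H.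
  have : ~~ (fullv <= H)%VS.
    apply: contraTN isT => /dimvS; rewrite dimV; move: hypH; rewrite /hyperplane dimV.
    by case=> ->.
  by case/subvPn => v _ v_notin; exists v.
have prim_z := generator_primitive cardF dimL z_prim.
have [zeta [zetaE hillE]] := hill_class_generator cardK prim_z.
apply: (no_hill_section cardF dimV dimL hypH fK gK v0_notin cardC zetaE _ sizes) => x.
have coordE : coord_map s g v0 (x, 0) = vsval (g x) :> V.
  have /eqP s0 : s_inv s 0 == 0 by rewrite s_inv_eq0.
  by rewrite /coord_map /= s0 scale0r addr0.
have baseE := hill_base cardF dimL z_prim fK gK equiv x.
apply/cap_vectorsP/idP; rewrite coordE.
  by move/baseE/hillE/(hill_classP cardK _ zetaE).
by move/(hill_classP cardK _ zetaE)/hillE/baseE.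
Qed.

Local Close Scope ring_scope.

Theorem theorem1p1 (F : finFieldType) (cardF : #|F| = 4)
    (V : vectType F) (dimV : \dim {:V} = 7)
    (L : fieldExtType F) (dimL : \dim {:L} = 6)
    (z : {unit finvect_type L}) (z_prim : generator [set: {unit finvect_type L}] z)
    (C : {set point V}) :
  cap 430 C -> two_intersection_sizes C ->
  ~ exists H : {vspace V},
      hyperplane H /\ projectively_equivalent (section_in H C) (hill_cap z).
Proof.
case=> cardC _.
exact: (no_hill_hyperplane_section cardF dimV dimL z_prim cardC).
Qed.
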